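(* Let $N\ge2$, let $Y_1,\dots,Y_N\in[C]$ be i.i.d. with $\mathbb{P}(Y_i=a)=\pi_a$, $Y=(Y_1,\dots,Y_N)$. Let $A\in\{0,1\}^{N\times N}$ be a random symmetric matrix with zero diagonal such that for each $i<j$, $A_{ij}\mid(Y_i=a,Y_j=b)\sim\mathrm{Bern}(B_{ab})$, and $\{A_{ij}\}_{i<j}$ are independent given $Y$, where $B_{aa}=p_{\mathrm{in}}$ and $B_{ab}=p_{\mathrm{out}}$ for $a\ne b$, with $p_{\mathrm{in}},p_{\mathrm{out}}\in[0,1]$. Let $\alpha=\sum_a\pi_a^2$, $\bar\alpha=1-\alpha$, $\bar p=\alpha p_{\mathrm{in}}+\bar\alpha p_{\mathrm{out}}$, $\Delta=p_{\mathrm{in}}-p_{\mathrm{out}}$, and assume $\bar p\in(0,1)$. Then for all $i<j$ $$I(A_{ij};Y_i,Y_j)\ge 2\,\alpha\bar\alpha\,\Delta^2 .$$ Furthermore, let $X$ be a feature variable and let $H_A$ be a representation that is task-sufficient for $Y$ given $X$ (defined in the context). (Case 1: featureless.) If $X$ is absent or constant, then $$I(A;H_A)\ge I(A;Y)\ge I(A_{12};Y_1,Y_2)\ge 2\,\alpha\bar\alpha\,\Delta^2 .$$ (Case 2: informative features.) For general $X$, $I(A;H_A\mid X)\ge I(A;Y\mid X)$, while $I(A;Y)\ge 2\,\alpha\bar\alpha\,\Delta^2$.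
   Context: $[C]=\{1,\dots,C\}$. Given $Y=y$, the edges $A_{ij}$ $(i<j)$ are independent Bernoulli variables with parameters $B_{y_iy_j}$. Task-sufficiency of $H_A$ for $Y$ given $X$: $(A,X,Y,H_A)$ are jointly distributed, $H_A=h(A,X,\xi)$ with $h$ measurable and $\xi$ conditionally independent of $Y$ given $(A,X)$, and $Y$ is conditionally independent of $A$ given $(H_A,X)$ (equivalently $I(H_A;Y\mid X)=I(A;Y\mid X)$). $I(\cdot;\cdot)$ and $I(\cdot;\cdot\mid\cdot)$ are mutual information and conditional mutual information, measured in nats (natural logarithm). *)

(* Defs.v *)
(* Libraries: MathComp and MathComp-Analysis. *)
From HB Require Import structures.
From mathcomp Require Import all_boot all_order all_algebra.
From mathcomp Require Import all_classical all_reals all_analysis.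

Set Implicit Arguments.
Unset Strict Implicit.
Unset Printing Implicit Defensive.

Import Order.TTheory GRing.Theory Num.Theory.
Import numFieldNormedType.Exports.

Local Open Scope classical_set_scope.
Local Open Scope ring_scope.
Local Open Scope charge_scope.

(* Label spaces, label vectors and adjacency matrices carry the discrete
   sigma-algebra.  Measurable types are nonempty in the library, hence the
   successor in the number of labels. *)
HB.instance Definition _ (c : nat) := isPointed.Build 'I_c.+1 ord0.

HB.instance Definition _ (c : nat) :=
  @isMeasurable.Build default_measure_display 'I_c.+1
    discrete_measurable discrete_measurable0
    discrete_measurableC discrete_measurableU.

HB.instance Definition _ (N c : nat) :=
  isPointed.Build {ffun 'I_N -> 'I_c.+1} [ffun=> ord0].

HB.instance Definition _ (N c : nat) :=
  @isMeasurable.Build default_measure_display {ffun 'I_N -> 'I_c.+1}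
    discrete_measurable discrete_measurable0
    discrete_measurableC discrete_measurableU.

HB.instance Definition _ (N : nat) :=
  @isMeasurable.Build default_measure_display 'M[bool]_N
    discrete_measurable discrete_measurable0
    discrete_measurableC discrete_measurableU.

Definition entry (N : nat) (i j : 'I_N) (m : 'M[bool]_N) : bool := m i j.

Lemma measurable_entry (N : nat) (i j : 'I_N) :
  measurable_fun setT (@entry N i j).
Proof. by []. Qed.

HB.instance Definition _ (N : nat) (i j : 'I_N) :=
  isMeasurableFun.Build _ _ _ _ (@entry N i j) (@measurable_entry N i j).

Definition coordinate (N c : nat) (i : 'I_N) (y : {ffun 'I_N -> 'I_c.+1}) :
  'I_c.+1 := y i.

Lemma measurable_coordinate (N c : nat) (i : 'I_N) :
  measurable_fun setT (@coordinate N c i).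
Proof. by []. Qed.

HB.instance Definition _ (N c : nat) (i : 'I_N) :=
  isMeasurableFun.Build _ _ _ _ (@coordinate N c i)
    (@measurable_coordinate N c i).

Section paired_variable.
Context d1 d2 d3 (T1 : measurableType d1) (T2 : measurableType d2)
  (T3 : measurableType d3) (U : {mfun T1 >-> T2}) (V : {mfun T1 >-> T3}).

Definition paired : T1 -> T2 * T3 := fun w => (U w, V w).

Lemma measurable_paired : measurable_fun setT paired.
Proof. by apply: measurable_fun_pair; exact: measurable_funPT. Qed.

HB.instance Definition _ :=
  isMeasurableFun.Build _ _ _ _ paired measurable_paired.

End paired_variable.

Section event_law.
Context (R : realType) d d1 d2 (W : measurableType d) (P : probability W R)
  (T1 : measurableType d1) (T2 : measurableType d2).
Variables (U : {RV P >-> T1}) (E : set T1) (mE : measurable E)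
  (Z : {RV P >-> T2}).

Definition event_law of measurable E : set T2 -> \bar R :=
  fun B => P (U @^-1` E `&` Z @^-1` B).

Let event_law0 : event_law mE set0 = 0%E.
Proof. by rewrite /event_law preimage_set0 setI0 measure0. Qed.

Let mU : measurable (U @^-1` E).
Proof. exact: measurable_funPTI. Qed.

Let mUZ B : measurable B -> measurable (U @^-1` E `&` Z @^-1` B).
Proof. by move=> mB; apply: measurableI => //; exact: measurable_funPTI. Qed.

Let event_law_fin B : measurable B -> event_law mE B \is a fin_num.
Proof. by move=> mB; apply: fin_num_measure; exact: mUZ. Qed.

Let event_law_sigma_additive : semi_sigma_additive (event_law mE).
Proof.
move=> F mF tF mUF; rewrite /event_law preimage_bigcup setI_bigcupr.
apply: measure_semi_sigma_additive.
- by move=> n; exact: mUZ.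
- apply/trivIsetP => /= i j _ _ ij.
  rewrite setIACA setIid -preimage_setI.
  by move/trivIsetP : tF => /(_ _ _ _ _ ij) ->//; rewrite preimage_set0 setI0.
- by rewrite -setI_bigcupr -preimage_bigcup; exact: mUZ.
Qed.

HB.instance Definition _ := isCharge.Build _ _ _ (event_law mE)
  event_law0 event_law_fin event_law_sigma_additive.

End event_law.

Section information.
Context (R : realType).

(* Relative entropy D(mu || nu), in nats. *)
Definition relative_entropy d (T : measurableType d) (mu nu : probability T R) :
    \bar R :=
  if `[< mu `<< nu >] then
    (\int[mu]_x lne (('d (charge_of_finite_measure mu) '/d nu) x))%E
  else +oo%E.

Context d (W : measurableType d) (P : probability W R).

Definition mutual_information d1 d2 (T1 : measurableType d1)
    (T2 : measurableType d2) (U : {RV P >-> T1}) (V : {RV P >-> T2}) : \bar R :=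
  relative_entropy (distribution P (paired U V))
    (distribution P U \x distribution P V)%E.

(* A version of z |-> P(U \in E | Z = z): the density of
   B |-> P(U \in E, Z \in B) with respect to the law of Z. *)
Definition cond_prob d1 d2 (T1 : measurableType d1) (T2 : measurableType d2)
    (U : {RV P >-> T1}) (E : set T1) (mE : measurable E) (Z : {RV P >-> T2}) :
    T2 -> \bar R :=
  'd (event_law U Z mE) '/d (distribution P Z).

Definition cond_independent d1 d2 d3 (T1 : measurableType d1)
    (T2 : measurableType d2) (T3 : measurableType d3)
    (U : {RV P >-> T1}) (V : {RV P >-> T2}) (Z : {RV P >-> T3}) : Prop :=
  forall (E : set T1) (F : set T2) (mE : measurable E) (mF : measurable F),
    ae_eq (distribution P Z) setT
      (cond_prob (paired U V) (measurableX mE mF) Z)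
      (fun z => cond_prob U mE Z z * cond_prob V mF Z z)%E.

(* Q has the same (U, Z)- and (V, Z)-marginals as the law of ((U, V), Z), and
   makes U and V conditionally independent given Z. *)
Definition is_cond_product_law d1 d2 d3 (T1 : measurableType d1)
    (T2 : measurableType d2) (T3 : measurableType d3)
    (U : {RV P >-> T1}) (V : {RV P >-> T2}) (Z : {RV P >-> T3})
    (Q : probability ((T1 * T2) * T3)%type R) : Prop :=
  forall (E : set T1) (F : set T2) (G : set T3)
    (mE : measurable E) (mF : measurable F), measurable G ->
    (Q ((E `*` F) `*` G) =
     \int[distribution P Z]_(z in G) (cond_prob U mE Z z * cond_prob V mF Z z))%E.

(* I(U; V | Z) = D(P_(U,V,Z) || Q), with Q the conditional product law.  Q is
   unique, since rectangles determine it, so that the infimum ranges over a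
   single value; Q exists as soon as U takes finitely many values, as the
   measure E |-> \sum_u \int P(U = u | Z) 1_E(u, V, Z) dP. *)
Definition cond_mutual_information d1 d2 d3 (T1 : measurableType d1)
    (T2 : measurableType d2) (T3 : measurableType d3)
    (U : {RV P >-> T1}) (V : {RV P >-> T2}) (Z : {RV P >-> T3}) : \bar R :=
  ereal_inf [set relative_entropy (distribution P (paired (paired U V) Z)) Q
            | Q in is_cond_product_law U V Z].

(* Mutual independence of the variables (Z i), i \in J, under the set function
   pr, which is P itself or its conditioning on an event. *)
Definition mutually_independent (pr : set W -> R) (I : finType) (J : {set I})
    d1 (T : measurableType d1) (Z : I -> W -> T) : Prop :=
  forall (K : {set I}) (E : I -> set T), K \subset J ->
    (forall i, measurable (E i)) ->
    pr (\bigcap_(i in [set` K]) (Z i @^-1` E i)) =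
    \prod_(i in K) pr (Z i @^-1` E i).

Definition prob (E : set W) : R := fine (P E).

Definition prob_given (F E : set W) : R := prob (E `&` F) / prob F.

End information.

Section block_model.
Context (R : realType) d (W : measurableType d) (P : probability W R).
Context (N c : nat).

Definition connectivity (p_in p_out : R) (a b : 'I_c.+1) : R :=
  if a == b then p_in else p_out.

Record is_sbm (pi : 'I_c.+1 -> R) (p_in p_out : R)
    (Y : {RV P >-> {ffun 'I_N -> 'I_c.+1}}) (A : {RV P >-> 'M[bool]_N}) :
    Prop := IsSBM {
  sbm_label_law : forall i a, prob P [set w | Y w i = a] = pi a ;
  sbm_label_indep : mutually_independent (prob P) [set: 'I_N]%SET
    (fun i w => Y w i) ;
  sbm_symmetric : forall w i j, A w i j = A w j i ;
  sbm_no_loop : forall w i, A w i i = false ;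
  sbm_edge_law : forall y : {ffun 'I_N -> 'I_c.+1},
    0 < prob P [set w | Y w = y] -> forall i j : 'I_N, (i < j)%N ->
    prob_given P [set w | Y w = y] [set w | A w i j] =
    connectivity p_in p_out (y i) (y j) ;
  sbm_edge_indep : forall y : {ffun 'I_N -> 'I_c.+1},
    0 < prob P [set w | Y w = y] ->
    mutually_independent (prob_given P [set w | Y w = y])
      [set e : 'I_N * 'I_N | (e.1 < e.2)%N]%SET (fun e w => A w e.1 e.2)
}.

Definition edge (A : {RV P >-> 'M[bool]_N}) (i j : 'I_N) : {RV P >-> bool} :=
  @entry N i j \o A.

Definition label_pair (Y : {RV P >-> {ffun 'I_N -> 'I_c.+1}}) (i j : 'I_N) :
    {RV P >-> ('I_c.+1 * 'I_c.+1)%type} :=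
  paired (@coordinate N c i \o Y) (@coordinate N c j \o Y).

End block_model.

Section task_sufficiency.
Context (R : realType) d (W : measurableType d) (P : probability W R).

Record task_sufficient dA dX dY dH (TA : measurableType dA)
    (TX : measurableType dX) (TY : measurableType dY) (TH : measurableType dH)
    (A : {RV P >-> TA}) (X : {RV P >-> TX}) (Y : {RV P >-> TY})
    (H : {RV P >-> TH}) : Prop := TaskSufficient {
  sufficient_representation :
    exists (dS : measure_display) (TS : measurableType dS)
      (xi : {RV P >-> TS}) (h : {mfun ((TA * TX) * TS)%type >-> TH}),
      (forall w, H w = h ((A w, X w), xi w)) /\
      cond_independent xi Y (paired A X) ;
  sufficient_cond_indep : cond_independent Y A (paired H X)
}.

Record task_sufficient_featureless dA dY dH (TA : measurableType dA)
    (TY : measurableType dY) (TH : measurableType dH)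
    (A : {RV P >-> TA}) (Y : {RV P >-> TY}) (H : {RV P >-> TH}) : Prop :=
    TaskSufficientFeatureless {
  featureless_representation :
    exists (dS : measure_display) (TS : measurableType dS)
      (xi : {RV P >-> TS}) (h : {mfun (TA * TS)%type >-> TH}),
      (forall w, H w = h (A w, xi w)) /\ cond_independent xi Y A ;
  featureless_cond_indep : cond_independent Y A H
}.

End task_sufficiency.

(* Main.v *)
(* Everything rests on one consequence of [ln x <= x - 1]: if [mu = k nu] and
   [h >= 0] has [\int h dnu <= 1], then [\int ln h dmu <= \int ln k dmu], the
   relative entropy of mu to nu.  Taking for h the pulled-back density of the
   images of mu and nu gives the data processing inequality.

   If Y and A are independent given V, and the law nu on (a, y, v) makes Y
   depend on (a, v) through the same conditional law given v as under P, then
   the density of the law of (A, V) with respect to the (a, v)-marginal of nu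
   is also a density of the law of (A, (Y, V)) with respect to nu.  Hence
   inserting Y does not increase the relative entropy, and forgetting V then
   yields I(A; Y) <= I(A; V).  With V = (H, X), and with nu the law that makes
   A and (Y, H) independent given X, the same argument gives
   I(A; Y | X) <= I(A; H | X).

   For the edge bound, h (e, a, b) = exp (t (e - p_bar) - t^2 / 8) with
   t = 4 (B_ab - p_bar).  Hoeffding's lemma for Bernoulli variables gives
   [\int h dnu <= 1], and the integral of ln h is 2 Var (B) =
   2 alpha (1 - alpha) (p_in - p_out)^2. *)
Require Import Defs.
From HB Require Import structures.
From mathcomp Require Import all_boot all_order all_algebra.
From mathcomp Require Import all_classical all_reals all_analysis.
From mathcomp Require Import measurable_realfun ring lra.

Set Implicit Arguments.
Unset Strict Implicit.
Unset Printing Implicit Defensive.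

Import Order.TTheory GRing.Theory Num.Theory.
Import numFieldNormedType.Exports.

Local Open Scope classical_set_scope.
Local Open Scope ring_scope.

(** * Densities and relative entropy *)

Section density.
Local Open Scope ereal_scope.
Context {R : realType} d {T : measurableType d}.

(** Real values and nonnegativity are imposed at every point, so that [ln] and inverses of [k] can
    be taken pointwise. *)
Definition is_density (nu mu : set T -> \bar R) (k : T -> R) :=
  [/\ measurable_fun setT k, (forall x, 0 <= k x)%R &
      forall E, measurable E -> nu E = \int[mu]_(x in E) (k x)%:E].

Lemma dominates_density (nu mu : {measure set T -> \bar R}) (k : T -> R) :
  is_density nu mu k -> nu `<< mu.
Proof.
move=> [mk k0 nuE]; apply/null_content_dominatesP => E mE E0.
by rewrite nuE// null_set_integral//; apply/measurable_EFinP/measurable_funTS.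
Qed.

(** The sigma-finite Radon-Nikodym function is finite and nonnegative at every point, so [fine]
    loses nothing. *)
Lemma exists_density (nu : {finite_measure set T -> \bar R})
    (mu : {sigma_finite_measure set T -> \bar R}) :
  nu `<< mu -> exists k : T -> R, is_density nu mu k.
Proof.
move=> numu; set f := Radon_Nikodym_SigmaFinite.f nu mu.
have ff x : f x \is a fin_num by exact: Radon_Nikodym_SigmaFinite.f_fin_num.
exists (fine \o f); split.
- apply: measurableT_comp => //.
  exact: measurable_int (Radon_Nikodym_SigmaFinite.f_integrable numu).
- by move=> x; rewrite fine_ge0// Radon_Nikodym_SigmaFinite.f_ge0.
- move=> E mE; rewrite (Radon_Nikodym_SigmaFinite.f_integral numu)//.
  by apply: eq_integral => x _; rewrite fineK.
Qed.

(** Two densities of [nu] agree [mu]-a.e., so the change of variables for the Radon-Nikodym function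
    carries over to [k]. *)
Lemma integral_density (nu : {finite_measure set T -> \bar R})
    (mu : {sigma_finite_measure set T -> \bar R}) (k : T -> R)
    (f : T -> \bar R) (E : set T) :
  is_density nu mu k -> measurable E -> (forall x, 0 <= f x) ->
  measurable_fun E f ->
  \int[nu]_(x in E) f x = \int[mu]_(x in E) (f x * (k x)%:E).
Proof.
move=> kd mE f0 mf; have [mk k0 nuE] := kd.
have numu := dominates_density kd.
have mEk : measurable_fun E (EFin \o k).
  exact/measurable_EFinP/measurable_funTS.
have mr : measurable_fun E (Radon_Nikodym_SigmaFinite.f nu mu).
  apply: measurable_funTS.
  exact: measurable_int (Radon_Nikodym_SigmaFinite.f_integrable numu).
rewrite -(Radon_Nikodym_SigmaFinite.change_of_variables numu)//.
apply: ge0_ae_eq_integral => //.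
- exact: emeasurable_funM.
- exact: emeasurable_funM.
- by move=> x _; rewrite mule_ge0// Radon_Nikodym_SigmaFinite.f_ge0.
- by move=> x _; rewrite mule_ge0// lee_fin.
apply: ae_eqe_mul2l; apply: integral_ae_eq => //.
- apply: (integrableS measurableT) => //.
  exact: Radon_Nikodym_SigmaFinite.f_integrable.
- by move=> A AE mA; rewrite -nuE// -Radon_Nikodym_SigmaFinite.f_integral.
Qed.

Lemma density_gt0 (nu : {finite_measure set T -> \bar R})
    (mu : {sigma_finite_measure set T -> \bar R}) (k : T -> R) :
  is_density nu mu k -> {ae nu, forall x, (0 < k x)%R}.
Proof.
move=> [mk k0 nuE]; exists (k @^-1` [set 0%R]); split.
- by rewrite -[X in measurable X]setTI; apply: mk.
- rewrite nuE; last by rewrite -[X in measurable X]setTI; apply: mk.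
  rewrite (eq_integral (cst 0)) ?integral0// => x /[!inE] kx.
  by rewrite kx.
- move=> x /= kx; apply/eqP; move/negP: kx.
  by rewrite lt_neqAle k0 andbT negbK eq_sym.
Qed.

End density.

(** Off the zero set the inverse is [expR (- ln (f x))]; on it the convention [0^-1 = 0] applies. *)
Lemma measurable_fun_inv_ge0 {R : realType} d {T : measurableType d}
    (f : T -> R) : (forall x, 0 <= f x) -> measurable_fun setT f ->
  measurable_fun setT (fun x => (f x)^-1).
Proof.
move=> f0 mf.
rewrite (_ : (fun x => _) =
    fun x => if f x <= 0 then 0 else expR (- ln (f x))); last first.
  apply/funext => x; case: ifPn => [fx|]; last first.
    by rewrite -ltNge => fx; rewrite expRN lnK// posrE.
  by rewrite (_ : f x = 0) ?invr0//; apply/eqP; rewrite eq_le fx f0.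
apply: measurable_fun_ifT => //; first exact: measurable_fun_ler.
by do 2 apply: measurableT_comp => //; exact: measurableT_comp.
Qed.

(** * Gibbs' inequality *)

Section integral_log.
Local Open Scope ereal_scope.
Context {R : realType} d {T : measurableType d}.

(** Positive and negative parts are compared separately, which covers infinite integrals. *)
Lemma ae_le_integral (mu : {measure set T -> \bar R}) (f g : T -> \bar R) :
  measurable_fun setT f -> measurable_fun setT g ->
  {ae mu, forall x, f x <= g x} -> \int[mu]_x f x <= \int[mu]_x g x.
Proof.
move=> mf mg fg; rewrite integralE [leRHS]integralE; apply: leeB.
- apply: ae_ge0_le_integral => //; [exact: measurable_funepos..|].
  by apply: filterS fg => x fgx _; rewrite !funeposE ge_max !le_max fgx/= lexx orbT.
- apply: ae_ge0_le_integral => //; [exact: measurable_funeneg..|].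
  apply: filterS fg => x fgx _.
  by rewrite !funenegE ge_max !le_max leeN2 fgx/= lexx orbT.
Qed.

Lemma measurable_fun_lne (f : T -> R) : measurable_fun setT f ->
  measurable_fun setT (fun x => lne (f x)%:E).
Proof.
move=> mf; rewrite /lne; apply: measurable_fun_ifT => //.
- exact: measurable_fun_ler.
- exact/measurable_EFinP/measurableT_comp.
Qed.

(** Versions of the density agree [nu]-a.e., hence [mu]-a.e. by domination; positivity of [k] for
    [mu] then turns [lne] into [ln]. *)
Lemma relative_entropy_density (mu nu : probability T R) (k : T -> R) :
  is_density mu nu k ->
  relative_entropy mu nu = \int[mu]_x (ln (k x))%:E.
Proof.
move=> kd; have munu := dominates_density kd.
have [mk k0 muE] := kd.
rewrite /relative_entropy asboolT//.
set g := Radon_Nikodym _ _.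
have mg : measurable_fun setT g.
  by apply: (@measurable_int _ _ _ nu); exact: Radon_Nikodym_integrable.
have gf x : g x \is a fin_num by exact: Radon_Nikodym_fin_num.
have gk : ae_eq mu setT g (EFin \o k).
  apply: (null_dominates_ae_eq _ munu) => //.
  apply: integral_ae_eq => //.
  - exact: Radon_Nikodym_integrable.
  - exact/measurable_EFinP.
  - by move=> E _ mE; rewrite -Radon_Nikodym_integral// -muE.
apply: ae_eq_integral => //.
- rewrite (_ : (fun x => _) = (fun x => lne (fine (g x))%:E)); last first.
    by apply/funext => x; rewrite fineK.
  exact/measurable_fun_lne/measurableT_comp.
- exact/measurable_EFinP/measurableT_comp.
apply: filterS2 gk (density_gt0 kd) => x /(_ I) /= -> kx _.
by rewrite lne_EFin.
Qed.

(* Positivity of h is needed mu-a.e. because [ln] is [0], not [-oo], at [0]. *)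
Lemma gibbs_inequality (mu nu : probability T R) (h : T -> R) :
  measurable_fun setT h -> (forall x, 0 <= h x)%R ->
  {ae mu, forall x, (0 < h x)%R} -> \int[nu]_x (h x)%:E <= 1 ->
  \int[mu]_x (ln (h x))%:E <= relative_entropy mu nu.
Proof.
move=> mh h0 hgt0 h1.
have [munu|nmunu] := pselect (mu `<< nu); last first.
  by rewrite /relative_entropy asboolF// leey.
have [k kd] := exists_density munu; have [mk k0 muE] := kd.
rewrite (relative_entropy_density kd).
have mlnk : measurable_fun setT (EFin \o (@ln R \o k)).
  exact/measurable_EFinP/measurableT_comp.
have mlnh : measurable_fun setT (EFin \o (@ln R \o h)).
  exact/measurable_EFinP/measurableT_comp.
have mV : measurable_fun setT (EFin \o (fun x => (k x)^-1)%R).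
  exact/measurable_EFinP/measurable_fun_inv_ge0.
have mhV : measurable_fun setT (EFin \o (fun x => h x / k x)%R).
  by apply/measurable_EFinP/measurable_funM => //; exact/measurable_EFinP.
(* Equality fails where [k] vanishes, since [0^-1 = 0]. *)
have kV1 x : ((k x)^-1 * k x <= 1)%R.
  by have [->|kx] := eqVneq (k x) 0%R; rewrite ?mulr0// mulVf.
have intV : \int[mu]_x ((k x)^-1)%:E <= 1.
  rewrite (integral_density kd)//; last by move=> x; rewrite lee_fin invr_ge0.
  apply: (@le_trans _ _ (\int[nu]_x (cst 1 x))).
    apply: ge0_le_integral => //.
    - by move=> x _; rewrite mule_ge0// lee_fin// invr_ge0.
    - by apply: emeasurable_funM => //; exact/measurable_EFinP.
    - by move=> x _; rewrite -EFinM lee_fin.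
  by rewrite integral_cst// mul1e; exact: probability_le1.
have inthV : \int[mu]_x (h x / k x)%:E <= 1.
  rewrite (integral_density kd)//; last by move=> x; rewrite lee_fin divr_ge0.
  apply: le_trans h1; apply: ge0_le_integral => //.
  - by move=> x _; rewrite mule_ge0// lee_fin// divr_ge0.
  - by apply: emeasurable_funM => //; exact/measurable_EFinP.
  - exact/measurable_EFinP.
  - by move=> x _; rewrite -EFinM lee_fin -mulrA ler_piMr.
(* Where [k] is positive, [- ln k = ln k^-1] is at most [k^-1]; so the negative part of [ln k] has
   finite integral and [oo - oo] cannot occur. *)
have intFn : \int[mu]_x (EFin \o (@ln R \o k))^\- x <= 1.
  apply: le_trans intV; apply: ge0_le_integral => //.
    exact: measurable_funeneg.
  move=> x _; rewrite funenegE ge_max /= !lee_fin invr_ge0 k0 andbT.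
  have [kx|kx] := ltP 0%R (k x); last by rewrite ln0// oppr0 invr_ge0.
  by rewrite -lnV ?posrE// ltW// ln_sublinear// invr_gt0.
have intFn_fin : \int[mu]_x (EFin \o (@ln R \o k))^\- x < +oo.
  by rewrite (le_lt_trans intFn)// ltry.
(* If the positive part has infinite integral, the relative entropy is [+oo]; otherwise [ln k] is
   integrable. *)
have [Foo|Ffin] := eqVneq (\int[mu]_x (EFin \o (@ln R \o k))^\+ x) +oo.
  suff -> : \int[mu]_x (ln (k x))%:E = +oo by exact: leey.
  rewrite integralE Foo addye//; apply/eqP => /eqP.
  by rewrite eqe_oppLR/= => /eqP e; move: intFn_fin; rewrite e.
have iF : mu.-integrable setT (EFin \o (@ln R \o k)).
  apply/integrableP; split => //.
  rewrite -[X in integral _ _ X]/(abse \o (EFin \o (@ln R \o k))) fune_abse.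
  rewrite ge0_integralD//; [|exact: measurable_funepos|exact: measurable_funeneg].
  by rewrite lte_add_pinfty// ltey.
have ihV : mu.-integrable setT (EFin \o (fun x => h x / k x)%R).
  apply/integrableP; split => //.
  under eq_integral => x _ do rewrite gee0_abs ?lee_fin ?divr_ge0//.
  by rewrite (le_lt_trans inthV)// ltry.
have i1 : mu.-integrable setT (cst (1%:E : \bar R)).
  exact: finite_measure_integrable_cst.
(* The bound [ln x <= x - 1] at [x = h / k] gives [ln h <= ln k + (h / k - 1)] [mu]-a.e., and the
   bracket integrates to at most [0]. *)
apply: (@le_trans _ _ (\int[mu]_x
    ((EFin \o (@ln R \o k)) \+ ((EFin \o (fun x => h x / k x)%R) \- cst 1%:E)) x)).
  apply: ae_le_integral => //.
    by apply: emeasurable_funD => //; exact: emeasurable_funB.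
  apply: filterS2 hgt0 (density_gt0 kd) => x hx kx /=.
  rewrite -EFinB -EFinD lee_fin -lerBlDl -ln_div ?posrE//.
  have hk : (0 < h x / k x)%R by rewrite divr_gt0.
  by rewrite -[X in ln X](subrKC 1%R) le_ln1Dx// ltrBrDl addrN.
rewrite integralD//; last exact: integrableB.
rewrite integralB// integral_cst// mul1e.
rewrite [X in _ + (_ - X)](_ : _ = 1); last exact: probability_setT.
rewrite -[leRHS]adde0 leeD2lE//; last first.
  exact: integrable_fin_num.
by rewrite leeBlDr// add0e.
Qed.

End integral_log.

(** * Data processing along a map *)

Section data_processing.
Local Open Scope ereal_scope.
Context {R : realType} d {T : measurableType d}.

Lemma integral_image d' (S : measurableType d') (m : {measure set T -> \bar R})
    (m' : {measure set S -> \bar R}) (p : T -> S) (f : S -> \bar R) :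
  measurable_fun setT p -> (forall E, measurable E -> m' E = m (p @^-1` E)) ->
  measurable_fun setT f ->
  \int[m']_x f x = \int[m]_x f (p x).
Proof.
move=> mp m'E mf.
have pushE (g : S -> \bar R) : measurable_fun setT g -> (forall x, 0 <= g x) ->
    \int[m']_x g x = \int[m]_x g (p x).
  move=> mg g0; rewrite -[RHS](ge0_integral_pushforward mp m measurableT)//.
  by apply: eq_measure_integral => E mE _; exact: m'E.
rewrite -[X in _ = integral _ _ X]/(f \o p).
rewrite integralE [RHS]integralE (funepos_comp f p) (funeneg_comp f p).
congr (_ - _); apply: pushE => //; first exact: measurable_funepos.
exact: measurable_funeneg.
Qed.

(** Gibbs' inequality with [h = k \o p], where [k] is a density of [mu'] with respect to [nu']: its
    [nu]-integral is [mu' setT]. The images are given by their values on measurable sets, so [nu']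
    may be a product measure. *)
Lemma relative_entropy_pushforward d' (S : measurableType d')
    (mu nu : probability T R) (mu' nu' : probability S R) (p : T -> S) :
  measurable_fun setT p ->
  (forall E, measurable E -> mu' E = mu (p @^-1` E)) ->
  (forall E, measurable E -> nu' E = nu (p @^-1` E)) ->
  relative_entropy mu' nu' <= relative_entropy mu nu.
Proof.
move=> mp mu'E nu'E.
have [munu|nmunu] := pselect (mu `<< nu); last first.
  by rewrite [leRHS]/relative_entropy asboolF// leey.
have mpE E : measurable E -> measurable (p @^-1` E).
  by move=> mE; rewrite -[X in measurable X]setTI; exact: mp.
have mu'nu' : mu' `<< nu'.
  apply/null_content_dominatesP => E mE E0; apply: etrans (mu'E E mE) _.
  move/null_content_dominatesP : munu; apply; first exact: mpE.
  exact: etrans (esym (nu'E E mE)) E0.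
have [k kd] := exists_density mu'nu'; have [mk k0 muE] := kd.
have mlnk : measurable_fun setT (EFin \o (@ln R \o k)).
  exact/measurable_EFinP/measurableT_comp.
rewrite (relative_entropy_density kd).
rewrite (integral_image mp mu'E mlnk).
  apply: gibbs_inequality => //.
  - exact: measurableT_comp.
  - have [N [mN N0 kN]] := density_gt0 kd.
    exists (p @^-1` N); split; [exact: mpE|by rewrite -mu'E|].
    by move=> x /= kx; apply: kN.
  - rewrite -(integral_image (f := EFin \o k) mp nu'E)//.
    + by rewrite -(muE _ measurableT); exact: probability_le1.
    + exact/measurable_EFinP.
Qed.

End data_processing.

(** * Laws determined by rectangles, and conditional densities *)

Section measures_on_rectangles.
Local Open Scope ereal_scope.
Context {R : realType} d1 d2 {T1 : measurableType d1} {T2 : measurableType d2}.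

(** Rectangles generate the product sigma-algebra and are stable under intersection. *)
Lemma eq_measure_rectangles (m1 m2 : {measure set (T1 * T2) -> \bar R}) :
  m1 setT < +oo ->
  (forall E F, measurable E -> measurable F -> m1 (E `*` F) = m2 (E `*` F)) ->
  forall D, measurable D -> m1 D = m2 D.
Proof.
move=> m1oo m12 D mD.
apply: (measure_unique [set E `*` F | E in measurable & F in measurable]
  (fun=> setT)) => //.
- by rewrite measurable_prod_measurableType.
- move=> _ _ [E1 mE1 [F1 mF1 <-]] [E2 mE2 [F2 mF2 <-]].
  rewrite -setXI; exists (E1 `&` E2); first exact: measurableI.
  by exists (F1 `&` F2) => //; exact: measurableI.
- by move=> i; exists setT => //; exists setT => //; rewrite setXTT.
- by apply/seteqP; split => // x _; exists 0%N.
- by move=> _ [E mE [F mF <-]]; exact: m12.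
Qed.

End measures_on_rectangles.

Section mutual_information_monotone.
Local Open Scope ereal_scope.
Context {R : realType} d {W : measurableType d} {P : probability W R}.
Context d1 d2 d1' d2' {T1 : measurableType d1} {T2 : measurableType d2}
  {S1 : measurableType d1'} {S2 : measurableType d2'}.

(** The map acting by [f] and [g] on the coordinates sends the product of the laws to the product of
    the image laws, so data processing applies. *)
Lemma mutual_information_comp (U : {RV P >-> T1}) (V : {RV P >-> T2})
    (U' : {RV P >-> S1}) (V' : {RV P >-> S2}) (f : T1 -> S1) (g : T2 -> S2) :
  measurable_fun setT f -> measurable_fun setT g ->
  (forall w, U' w = f (U w)) -> (forall w, V' w = g (V w)) ->
  mutual_information U' V' <= mutual_information U V.
Proof.
move=> mf mg U'E V'E; pose p (z : T1 * T2) := (f z.1, g z.2).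
have mp : measurable_fun setT p.
  by apply: measurable_fun_pair; apply: measurableT_comp.
apply: (relative_entropy_pushforward mp) => E mE.
  congr (P _); apply/seteqP; split => w /=;
    by rewrite /paired/= /p/= U'E V'E.
pose p' : {mfun _ >-> _} := HB.pack p (isMeasurableFun.Build _ _ _ _ p mp).
pose m' := distribution (distribution P U \x distribution P V) p'.
apply: (eq_trans (product_measure_unique (m' := m') _ mE)) => // A B mA mB.
transitivity ((distribution P U \x distribution P V)
  ((f @^-1` A) `*` (g @^-1` B))) => //.
have mfA : measurable (f @^-1` A) by rewrite -[X in measurable X]setTI; exact: mf.
have mgB : measurable (g @^-1` B) by rewrite -[X in measurable X]setTI; exact: mg.
rewrite product_measure1E//; congr (P _ * P _).
  by apply/seteqP; split => w /=; rewrite U'E.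
by apply/seteqP; split => w /=; rewrite V'E.
Qed.

End mutual_information_monotone.

Section sub_distribution.
Local Open Scope ereal_scope.
Context {R : realType} d {W : measurableType d} d' {S : measurableType d'}.
Variables (mu : {measure set W -> \bar R}) (D : set W) (mD : measurable D)
  (Z : {mfun W >-> S}).

(** The unnormalized law of [Z] on the event [D]. Unlike [event_law] it is a measure, over any base
    measure, so uniqueness of measures applies to it. *)
Definition sub_distribution of measurable D : set S -> \bar R :=
  fun B => mu (D `&` Z @^-1` B).

Let mDZ B : measurable B -> measurable (D `&` Z @^-1` B).
Proof. by move=> mB; apply: measurableI => //; exact: measurable_funPTI. Qed.

Let sub_distribution0 : sub_distribution mD set0 = 0.
Proof. by rewrite /sub_distribution preimage_set0 setI0 measure0. Qed.

Let sub_distribution_ge0 B : 0 <= sub_distribution mD B.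
Proof. exact: measure_ge0. Qed.

Let sub_distribution_sigma_additive :
  semi_sigma_additive (sub_distribution mD).
Proof.
move=> F mF tF mUF; rewrite /sub_distribution preimage_bigcup setI_bigcupr.
apply: measure_semi_sigma_additive.
- by move=> n; exact: mDZ.
- apply/trivIsetP => /= i j _ _ ij.
  rewrite setIACA setIid -preimage_setI.
  by move/trivIsetP : tF => /(_ _ _ _ _ ij) ->//; rewrite preimage_set0 setI0.
- by rewrite -setI_bigcupr -preimage_bigcup; exact: mDZ.
Qed.

HB.instance Definition _ := isMeasure.Build _ _ _ (sub_distribution mD)
  sub_distribution0 sub_distribution_ge0 sub_distribution_sigma_additive.

End sub_distribution.

Section finite_sub_distribution.
Local Open Scope ereal_scope.
Context {R : realType} d {W : measurableType d} d' {S : measurableType d'}.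
Variables (mu : {finite_measure set W -> \bar R}) (D : set W)
  (mD : measurable D) (Z : {mfun W >-> S}).

Let sub_distribution_fin : fin_num_fun (sub_distribution mu Z mD).
Proof.
move=> B mB; apply: fin_num_measure; apply: measurableI => //.
exact: measurable_funPTI.
Qed.

HB.instance Definition _ := Measure_isFinite.Build _ _ _
  (sub_distribution mu Z mD) sub_distribution_fin.

End finite_sub_distribution.

(** * Conditional probabilities as real densities *)

Section conditional_density.
Local Open Scope ereal_scope.
Context {R : realType} d {W : measurableType d} {P : probability W R}.
Context d' {S : measurableType d'}.

(* A real-valued version of [z |-> P (D | Z = z)]. *)
Definition cond_density (D : set W) (Z : {RV P >-> S}) (k : S -> R) :=
  is_density (fun B => P (D `&` Z @^-1` B)) (distribution P Z) k.

Lemma exists_cond_density (D : set W) (Z : {RV P >-> S}) :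
  measurable D -> exists k, cond_density D Z k.
Proof.
move=> mD.
suff /exists_density [k kd] : sub_distribution P Z mD `<< distribution P Z.
  by exists k.
apply/null_content_dominatesP => B mB B0.
apply/eqP; rewrite -measure_le0 -[leRHS]B0.
by apply: le_measure; rewrite ?inE//; first apply: measurableI => //;
  exact: measurable_funPTI.
Qed.

Lemma event_law_dominated d1 (T1 : measurableType d1) (U : {RV P >-> T1})
    (E : set T1) (mE : measurable E) (Z : {RV P >-> S}) :
  event_law U Z mE `<< distribution P Z.
Proof.
apply/null_content_dominatesP => B mB B0.
apply/eqP; rewrite -measure_le0 -[leRHS]B0.
by apply: le_measure; rewrite ?inE//; first apply: measurableI => //;
  exact: measurable_funPTI.
Qed.

Lemma measurable_cond_prob d1 (T1 : measurableType d1) (U : {RV P >-> T1})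
    (E : set T1) (mE : measurable E) (Z : {RV P >-> S}) :
  measurable_fun setT (cond_prob U mE Z).
Proof.
apply: (@measurable_int _ _ _ (distribution P Z)).
by apply: Radon_Nikodym_integrable; exact: event_law_dominated.
Qed.

(** Uniqueness of Radon-Nikodym derivatives; this links [cond_prob], in which conditional
    independence is expressed, to real-valued versions. *)
Lemma cond_prob_density d1 (T1 : measurableType d1) (U : {RV P >-> T1})
    (E : set T1) (mE : measurable E) (Z : {RV P >-> S}) (k : S -> R) :
  cond_density (U @^-1` E) Z k ->
  ae_eq (distribution P Z) setT (cond_prob U mE Z) (EFin \o k).
Proof.
move=> [mk k0 kE].
have dom := @event_law_dominated _ _ U E mE Z.
apply: integral_ae_eq => //.
- exact: Radon_Nikodym_integrable.
- exact/measurable_EFinP.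
- by move=> B _ mB; rewrite -Radon_Nikodym_integral// -kE.
Qed.

(** The defining property of conditional probability, extended from indicators to nonnegative
    functions of [Z]. *)
Lemma integral_cond_density (D : set W) (Z : {RV P >-> S}) (k : S -> R)
    (f : S -> \bar R) (B : set S) :
  measurable D -> cond_density D Z k -> measurable B ->
  measurable_fun setT f -> (forall z, 0 <= f z) ->
  \int[P]_(w in D `&` Z @^-1` B) f (Z w) =
  \int[distribution P Z]_(z in B) (f z * (k z)%:E).
Proof.
move=> mD kd mB mf f0.
have mZB : measurable (Z @^-1` B) by exact: measurable_funPTI.
have mfZ : measurable_fun setT (f \o Z) by exact: measurableT_comp.
rewrite -(@integral_density _ _ _ (sub_distribution P Z mD))//; last first.
  exact: measurable_funTS.
have indd : is_density (mrestr P mD) P \1_D.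
  by split => // E mE; rewrite integral_indic// setIC.
transitivity (\int[mrestr P mD]_(w in Z @^-1` B) (f \o Z) w).
  rewrite (integral_density indd)//; [|by move=> w; exact: f0|
    exact: measurable_funTS].
  by rewrite setIC integral_mkcondr epatch_indic.
rewrite -[LHS](ge0_integral_pushforward (measurable_funPT Z) (mrestr P mD) mB);
  [|exact: measurable_funTS|by []].
by apply: eq_measure_integral => A mA _; congr (P _); rewrite setIC.
Qed.

End conditional_density.

Section density_measure.
Local Open Scope ereal_scope.
Context {R : realType} d {T : measurableType d} (mu : {measure set T -> \bar R}).
Variables (k : T -> R) (mk : measurable_fun setT k) (k0 : forall x, (0 <= k x)%R).

(** The proofs about [k] are arguments so that the measure structure can be inferred from the term
    alone. *)
Definition density_measure of measurable_fun setT k & (forall x, (0 <= k x)%R) :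
  set T -> \bar R := fun E => \int[mu]_(x in E) (k x)%:E.

Let density_measure0 : density_measure mk k0 set0 = 0.
Proof. exact: integral_set0. Qed.

Let density_measure_ge0 E : 0 <= density_measure mk k0 E.
Proof. by apply: integral_ge0 => x _; rewrite lee_fin. Qed.

Let density_measure_sigma_additive : semi_sigma_additive (density_measure mk k0).
Proof.
apply: semi_sigma_additive_nng_induced; first exact/measurable_EFinP.
by move=> x; rewrite lee_fin.
Qed.

HB.instance Definition _ := isMeasure.Build _ _ _ (density_measure mk k0)
  density_measure0 density_measure_ge0 density_measure_sigma_additive.

End density_measure.

Section measures_on_boxes.
Local Open Scope ereal_scope.
Context {R : realType} d1 d2 {T1 : measurableType d1} {T2 : measurableType d2}.

(** The rectangle criterion is used twice: to split off the first factor and then, with [E] fixed,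
    on the last two. *)
Lemma eq_measure_boxes d3 {T3 : measurableType d3}
    (m1 m2 : {measure set (T1 * (T2 * T3)) -> \bar R}) :
  m1 setT < +oo ->
  (forall E F G, measurable E -> measurable F -> measurable G ->
    m1 (E `*` (F `*` G)) = m2 (E `*` (F `*` G))) ->
  forall D, measurable D -> m1 D = m2 D.
Proof.
move=> m1oo m12; apply: eq_measure_rectangles => // E D mE mD.
have mES : measurable (E `*` [set: T2 * T3]) by exact: measurableX.
pose p : {mfun (T1 * (T2 * T3))%type >-> (T2 * T3)%type} := HB.pack
  (@snd T1 (T2 * T3))
  (isMeasurableFun.Build _ _ _ _ _ (@measurable_snd _ _ T1 (T2 * T3)%type)).
have XE C : E `*` C = (E `*` setT) `&` p @^-1` C.
  by apply/seteqP; split => -[x y] /=; tauto.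
rewrite XE; apply: (eq_measure_rectangles
  (m1 := sub_distribution m1 p mES) (m2 := sub_distribution m2 p mES)) => //.
- apply: le_lt_trans m1oo; apply: le_measure; rewrite ?inE//.
  by rewrite preimage_setT setIT.
- by move=> F G mF mG; have := m12 _ _ _ mE mF mG; rewrite XE.
Qed.

End measures_on_boxes.

Section cond_density_on_rectangles.
Local Open Scope ereal_scope.
Context {R : realType} d {W : measurableType d} {P : probability W R}.
Context d1 d2 {S1 : measurableType d1} {S2 : measurableType d2}.

Lemma cond_density_rectangles (D : set W) (Z : {RV P >-> (S1 * S2)%type})
    (k : S1 * S2 -> R) :
  measurable D -> measurable_fun setT k -> (forall z, 0 <= k z)%R ->
  (forall E F, measurable E -> measurable F ->
     P (D `&` Z @^-1` (E `*` F)) =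
     \int[distribution P Z]_(z in E `*` F) (k z)%:E) ->
  cond_density D Z k.
Proof.
move=> mD mk k0 kE; split => // B mB.
apply: (eq_measure_rectangles (m1 := sub_distribution P Z mD)
  (m2 := density_measure (distribution P Z) mk k0)) => //.
rewrite /= /sub_distribution preimage_setT setIT.
by rewrite (le_lt_trans (probability_le1 P mD))// ltry.
Qed.

End cond_density_on_rectangles.

Section cond_independent_density.
Local Open Scope ereal_scope.
Context {R : realType} d {W : measurableType d} {P : probability W R}.
Context d1 d2 d3 {T1 : measurableType d1} {T2 : measurableType d2}
  {T3 : measurableType d3}.

(** The product formula for [cond_prob] transfers to any real versions [k] and [l], which agree with
    it almost everywhere. *)
Lemma cond_independent_density (U : {RV P >-> T1}) (V : {RV P >-> T2})
    (Z : {RV P >-> T3}) (E : set T1) (F : set T2) (k l : T3 -> R) :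
  cond_independent U V Z -> measurable E -> measurable F ->
  cond_density (U @^-1` E) Z k -> cond_density (V @^-1` F) Z l ->
  cond_density (U @^-1` E `&` V @^-1` F) Z (fun z => k z * l z)%R.
Proof.
move=> UVZ mE mF kd ld; have [mk k0 _] := kd; have [ml l0 _] := ld.
have mUE : measurable (U @^-1` E) by exact: measurable_funPTI.
have mVF : measurable (V @^-1` F) by exact: measurable_funPTI.
have [h hd] := exists_cond_density Z (measurableI _ _ mUE mVF).
have hd' : cond_density ((paired U V) @^-1` (E `*` F)) Z h by [].
have := UVZ E F mE mF => klE.
have hkl : ae_eq (distribution P Z) setT (EFin \o h) (fun z => (k z * l z)%:E).
  have ch := cond_prob_density (measurableX mE mF) hd'.
  have ck := cond_prob_density mE kd.
  have cl := cond_prob_density mF ld.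
  apply: filterS2 (filterI klE ch) (filterI ck cl) => z /= [e1 e2] [e3 e4] _.
  by rewrite -e2// e1// e3// e4// EFinM.
have [mh h0 hE] := hd.
split; [exact: measurable_funM|by move=> z; exact: mulr_ge0|].
move=> B mB; rewrite hE//; apply: ae_eq_integral => //.
- exact/measurable_EFinP/measurable_funTS.
- by apply/measurable_EFinP/measurable_funTS; exact: measurable_funM.
- exact: ae_eq_subset hkl.
Qed.

End cond_independent_density.

(** * Data processing along Markov chains *)

Section drop_middle.
Context d1 d2 d3 {T1 : measurableType d1} {T2 : measurableType d2}
  {T3 : measurableType d3}.

Definition drop_middle (z : T1 * (T2 * T3)) : T1 * T3 := (z.1, z.2.2).

Lemma measurable_drop_middle : measurable_fun setT drop_middle.
Proof.
apply: measurable_fun_pair; first exact: measurable_fst.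
by apply: measurableT_comp; [exact: measurable_snd|exact: measurable_snd].
Qed.

HB.instance Definition _ := isMeasurableFun.Build _ _ _ _
  drop_middle measurable_drop_middle.

End drop_middle.
Arguments drop_middle {d1 d2 d3 T1 T2 T3} z.

Section markov_chain_entropy.
Local Open Scope ereal_scope.
Context {R : realType} d {W : measurableType d} {P : probability W R}.
Context d1 d2 d3 {T1 : measurableType d1} {T2 : measurableType d2}
  {T3 : measurableType d3}.

(* The second hypothesis says that [k] is also, under nu, a conditional
   probability of [y \in F] given [(a, v)]. *)
Lemma relative_entropy_drop_middle (A : {RV P >-> T1}) (Y : {RV P >-> T2})
    (V : {RV P >-> T3}) (nu : probability (T1 * (T2 * T3))%type R) :
  cond_independent Y A V ->
  (forall F k, measurable F -> cond_density (Y @^-1` F) V k ->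
    cond_density (P := nu) [set z | F z.2.1] drop_middle (k \o snd)) ->
  relative_entropy (distribution P (paired A (paired Y V))) nu <=
  relative_entropy (distribution P (paired A V)) (distribution nu drop_middle).
Proof.
move=> YAV nuY; set mu : probability _ R := distribution P (paired A (paired Y V)).
set mu' : probability _ R := distribution P (paired A V).
set nu' : probability _ R := distribution nu drop_middle.
have [mu'nu'|nmu'nu'] := pselect (mu' `<< nu'); last first.
  by rewrite [leRHS]/relative_entropy asboolF// leey.
have [f fd] := exists_density mu'nu'; have [mf f0 mu'E] := fd.
have mfg : measurable_fun setT (f \o @drop_middle _ _ _ T1 T2 T3).
  exact: measurableT_comp.
have mlnf : measurable_fun setT (EFin \o (@ln R \o f)).
  exact/measurable_EFinP/measurableT_comp.
(* On a box, both sides are the integral over [A \in E], [V \in B] of the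
   conditional probability of [Y \in F] given V. *)
have fgd : is_density mu nu (f \o drop_middle).
  split => //; first by move=> z; exact: f0.
  have fg0 z : (0 <= (f \o @drop_middle _ _ _ T1 T2 T3) z)%R by exact: f0.
  apply: (eq_measure_boxes (m1 := mu) (m2 := density_measure nu mfg fg0)).
    by rewrite (le_lt_trans (probability_le1 mu measurableT))// ltry.
  move=> E F B mE mF mB.
  have mAE : measurable (A @^-1` E) by exact: measurable_funPTI.
  have mYF : measurable (Y @^-1` F) by exact: measurable_funPTI.
  have [k kd] := exists_cond_density V mAE.
  have [l ld] := exists_cond_density V mYF.
  have [_ _ klE] := cond_independent_density YAV mF mE ld kd.
  have [ml l0 _] := ld.
  have mcyl : measurable [set z : T1 * (T2 * T3) | F z.2.1].
    have -> : [set z : T1 * (T2 * T3) | F z.2.1] = setT `*` (F `*` setT).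
      by apply/seteqP; split => -[x [y z]] /=; tauto.
    by do 2 apply: measurableX => //.
  transitivity (P (Y @^-1` F `&` A @^-1` E `&` V @^-1` B)).
    by congr (P _); apply/seteqP; split => w /=; tauto.
  rewrite klE//.
  transitivity (\int[distribution P V]_(v in B) ((l v)%:E * (k v)%:E)).
    by apply: eq_integral => v _; rewrite EFinM.
  (* Reading [k] as the conditional probability of [A \in E] moves the integral back to [W], and
     from there to the joint law of [A] and [V]. *)
  rewrite -(integral_cond_density (f := EFin \o l) mAE kd)//;
    last exact/measurable_EFinP.
  have mEB : measurable (E `*` B) by exact: measurableX.
  transitivity (\int[mu']_(z in E `*` B) (l z.2)%:E).
    rewrite ge0_integral_pushforward//.
    - by apply/measurable_EFinP/measurable_funTS/measurableT_comp.
    - by move=> z _; rewrite lee_fin.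
  rewrite (integral_density fd); [|exact: mEB|by move=> z; rewrite lee_fin|
    by apply/measurable_EFinP/measurable_funTS/measurableT_comp].
  transitivity (\int[nu']_(z in E `*` B) ((f z)%:E * (l z.2)%:E)).
    by apply: eq_integral => z _; rewrite muleC.
  (* Since [l] is also a conditional probability of [y \in F] under [nu], the factor [l] becomes a
     restriction to the box. *)
  rewrite -(integral_cond_density (f := EFin \o f) mcyl (nuY _ _ mF ld))//;
    last exact/measurable_EFinP.
  by congr (integral _ _ _); apply/seteqP; split => -[x [y z]] /=; tauto.
(* Both densities come from [f], and [ln f] depends on [(a, v)] only, so here the two relative
   entropies are equal. *)
rewrite (relative_entropy_density fd) (relative_entropy_density fgd).
have mA : measurable_fun setT (@drop_middle _ _ _ T1 T2 T3) by [].
by rewrite (@integral_image _ _ _ _ _ mu mu' drop_middle (EFin \o (@ln R \o f))).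
Qed.

End markov_chain_entropy.

Section markov_chain_information.
Local Open Scope ereal_scope.
Context {R : realType} d {W : measurableType d} {P : probability W R}.
Context d1 d2 d3 {T1 : measurableType d1} {T2 : measurableType d2}
  {T3 : measurableType d3}.

(** The chain is [I(A; Y) <= I(A; (Y, V)) <= I(A; V)]: the first step is data processing, the second
    uses the Markov property. *)
Lemma mutual_information_markov (A : {RV P >-> T1}) (Y : {RV P >-> T2})
    (V : {RV P >-> T3}) :
  cond_independent Y A V -> mutual_information A Y <= mutual_information A V.
Proof.
move=> YAV; apply: (@le_trans _ _ (mutual_information A (paired Y V))).
  exact: (mutual_information_comp (f := id) (g := fst)).
(* Under this product law [a] is independent of [(y, v)], so the conditional law of [y] given
   [(a, v)] is the one given [v]. *)
set nu : probability _ R := (distribution P A \x distribution P (paired Y V)).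
have nu'E C : measurable C ->
    distribution nu drop_middle C = (distribution P A \x distribution P V) C.
  move=> mC; apply/esym.
  apply: (product_measure_unique (m' := distribution nu drop_middle)) => //.
  move=> E B mE mB.
  transitivity (nu (E `*` (setT `*` B))).
    by congr (nu _); apply/seteqP; split => -[x [y z]] /=; tauto.
  rewrite /nu/= product_measure1E//; last exact: measurableX.
  by congr (_ * P _); apply/seteqP; split => w /=; tauto.
apply: le_trans (relative_entropy_drop_middle (nu := nu) YAV _) _.
- move=> F k mF kd; have [mk k0 kE] := kd.
  apply: cond_density_rectangles.
  + have -> : [set z : T1 * (T2 * T3) | F z.2.1] = setT `*` (F `*` setT).
      by apply/seteqP; split => -[x [y z]] /=; tauto.
    by do 2 apply: measurableX => //.
  + exact: measurableT_comp.
  + by move=> z; exact: k0.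
  move=> E B mE mB.
  transitivity (nu (E `*` (F `*` B))).
    by congr (nu _); apply/seteqP; split => -[x [y z]] /=; tauto.
  rewrite (eq_measure_integral (distribution P A \x distribution P V)); last first.
    by move=> C mC _; exact: nu'E.
  rewrite /nu/= product_measure1E//; last exact: measurableX.
  rewrite [X in _ * X]kE//.
  set m : probability _ R := (distribution P A \x distribution P V).
  pose s : {RV m >-> T3} := HB.pack (@snd T1 T3)
    (isMeasurableFun.Build _ _ _ _ _ (@measurable_snd _ _ T1 T3)).
  have mE' : measurable (E `*` [set: T3]) by exact: measurableX.
  have EBE C : E `*` C = (E `*` setT) `&` s @^-1` C.
    by apply/seteqP; split => -[x y] /=; tauto.
  have sE C : measurable C -> distribution m s C = distribution P V C.
    move=> mC; transitivity (m (setT `*` C)).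
      by congr (m _); apply/seteqP; split => -[x y] /=; tauto.
    rewrite /m/= product_measure1E//.
    by rewrite [X in X * _](_ : _ = 1) ?mul1e//; exact: probability_setT.
  have cE : (fine (distribution P A E))%:E = distribution P A E.
    by rewrite fineK// fin_num_measure.
  (* By independence under [m], the conditional probability of [a \in E] given [v] is constant. *)
  have sd : cond_density (E `*` [set: T3]) s (cst (fine (distribution P A E))).
    split => [||C mC]; [exact: measurable_cst|by move=> z; exact: fine_ge0|].
    transitivity ((fine (distribution P A E))%:E * distribution m s C).
      by rewrite cE sE// -EBE /m/= product_measure1E.
    by rewrite -integral_cst.
  rewrite [in RHS]EBE.
  rewrite (integral_cond_density (f := EFin \o k) mE' sd mB)//; last first.
    exact/measurable_EFinP.
  rewrite [RHS](eq_measure_integral (distribution P V)); last first.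
    by move=> C mC _; exact: sE.
  transitivity (\int[distribution P V]_(z in B) (k z)%:E *
      (fine (distribution P A E))%:E); first by rewrite cE muleC.
  rewrite -ge0_integralZr//.
  + exact/measurable_EFinP/measurable_funTS.
  + by move=> z _; rewrite lee_fin.
  + by rewrite lee_fin fine_ge0.
(* The image of [nu] is known to equal the product law on measurable sets; data processing along the
   identity passes from one to the other. *)
- exact: (relative_entropy_pushforward (p := id)).
Qed.

End markov_chain_information.

(** * Conditional product laws *)

Section conditional_product_law.
Local Open Scope ereal_scope.
Context {R : realType} d {W : measurableType d} {P : probability W R}.
Context d1 d2 d3 {T1 : measurableType d1} {T2 : measurableType d2}
  {T3 : measurableType d3}.
Variables (U : {RV P >-> T1}) (V : {RV P >-> T2}) (Z : {RV P >-> T3}).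

Let integral_cond_prob (E : set T1) (F : set T2) (G : set T3)
    (mE : measurable E) (mF : measurable F) (k l : T3 -> R) :
  measurable G -> cond_density (U @^-1` E) Z k ->
  cond_density (V @^-1` F) Z l ->
  \int[distribution P Z]_(z in G) (cond_prob U mE Z z * cond_prob V mF Z z) =
  \int[distribution P Z]_(z in G) (k z * l z)%:E.
Proof.
move=> mG kd ld; have [mk _ _] := kd; have [ml _ _] := ld.
have mUE : measurable (U @^-1` E) by exact: measurable_funPTI.
have mVF : measurable (V @^-1` F) by exact: measurable_funPTI.
apply: ae_eq_integral => //.
- by apply: measurable_funTS; apply: emeasurable_funM; exact: measurable_cond_prob.
- by apply/measurable_EFinP/measurable_funTS; exact: measurable_funM.
- apply: (@ae_eq_subset _ _ _ _ _ setT) => //.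
  apply: filterS2 (cond_prob_density mE kd) (cond_prob_density mF ld) => z e1 e2 _.
  by rewrite e1// e2// EFinM.
Qed.

Lemma cond_product_law_density (Q : probability ((T1 * T2) * T3)%type R)
    (E : set T1) (F : set T2) (G : set T3) (k l : T3 -> R) :
  is_cond_product_law U V Z Q ->
  measurable E -> measurable F -> measurable G ->
  cond_density (U @^-1` E) Z k -> cond_density (V @^-1` F) Z l ->
  Q ((E `*` F) `*` G) = \int[distribution P Z]_(z in G) (k z * l z)%:E.
Proof.
move=> hQ mE mF mG kd ld; rewrite -(integral_cond_prob mE mF)//; exact: hQ.
Qed.

(** The integral sees versions only up to null sets, so one choice of [k] and [l] suffices for each
    [E] and [F]. *)
Lemma is_cond_product_law_density (Q : probability ((T1 * T2) * T3)%type R) :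
  (forall E F, measurable E -> measurable F ->
    exists k l, [/\ cond_density (U @^-1` E) Z k, cond_density (V @^-1` F) Z l &
      forall G, measurable G ->
      Q ((E `*` F) `*` G) = \int[distribution P Z]_(z in G) (k z * l z)%:E]) ->
  is_cond_product_law U V Z Q.
Proof.
move=> hQ E F G mE mF mG; have [k [l [kd ld ->//]]] := hQ E F mE mF.
by rewrite (integral_cond_prob mE mF mG kd ld).
Qed.

(** Under [Q] the conditional probability of the first coordinate lying in [E], given the other two,
    is [k] of the last one. On rectangles this follows by integrating out [V], and rectangles
    suffice. *)
Lemma cond_product_law_integral (Q : probability ((T1 * T2) * T3)%type R)
    (E : set T1) (k : T3 -> R) (C : set (T2 * T3)) :
  is_cond_product_law U V Z Q -> measurable E -> cond_density (U @^-1` E) Z k ->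
  measurable C ->
  Q [set x | E x.1.1 /\ C (x.1.2, x.2)] =
  \int[P]_(w in (paired V Z) @^-1` C) (k (Z w))%:E.
Proof.
move=> hQ mE kd mC; have [mk k0 _] := kd.
pose p (x : (T1 * T2) * T3) := (x.1.2, x.2).
have mp : measurable_fun setT p.
  apply: measurable_fun_pair; last exact: measurable_snd.
  by apply: measurableT_comp; [exact: measurable_snd|exact: measurable_fst].
pose p' : {mfun _ >-> _} := HB.pack p (isMeasurableFun.Build _ _ _ _ p mp).
have mE' : measurable ((E `*` [set: T2]) `*` [set: T3]).
  by do 2 apply: measurableX => //.
have mkZ : measurable_fun setT (k \o Z) by exact: measurableT_comp.
have kZ0 w : (0 <= (k \o Z) w)%R by exact: k0.
have pE D : [set x | E x.1.1 /\ D (x.1.2, x.2)] =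
    ((E `*` [set: T2]) `*` [set: T3]) `&` p' @^-1` D.
  by apply/seteqP; split => -[[x y] z] /=; tauto.
transitivity (sub_distribution (density_measure P mkZ kZ0) (paired V Z)
    measurableT C); last first.
  by rewrite /sub_distribution setTI.
rewrite pE; apply: (eq_measure_rectangles (m1 := sub_distribution Q p' mE')) => //.
  rewrite (le_lt_trans (probability_le1 Q _))// ?ltry//.
  by apply: measurableI => //; rewrite preimage_setT.
move=> F G mF mG; have mVF : measurable (V @^-1` F) by exact: measurable_funPTI.
have [l ld] := exists_cond_density Z mVF; have [ml l0 _] := ld.
transitivity (Q ((E `*` F) `*` G)).
  by congr (Q _); apply/seteqP; split => -[[x y] z] /=; tauto.
rewrite (cond_product_law_density hQ mE mF mG kd ld).
transitivity (\int[P]_(w in V @^-1` F `&` Z @^-1` G) (k (Z w))%:E).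
  rewrite (integral_cond_density (f := EFin \o k) mVF ld mG)//.
  exact/measurable_EFinP.
transitivity (\int[P]_(w in setT `&` paired V Z @^-1` (F `*` G)) (k (Z w))%:E);
  last by [].
by congr (integral _ _ _); apply/seteqP; split => w /=; tauto.
Qed.

Hypothesis mset1 : forall x : T1, measurable [set x].

(* The measure [C |-> \sum_u \int P (U = u | Z) 1_C (u, V, Z) dP]. *)
Lemma exists_cond_product_law : finite_set (range U) ->
  exists Q : probability ((T1 * T2) * T3)%type R, is_cond_product_law U V Z Q.
Proof.
(* Without duplicates, the events [U = e i] are disjoint; together they cover [W]. *)
move=> /finite_seqP[s0 s0E]; pose s := undup s0; pose n := size s.
pose e i := nth point s i.
have eI i j : (i < n)%N -> (j < n)%N -> e i = e j -> i = j.
  by move=> ni nj /eqP; rewrite nth_uniq ?undup_uniq// => /eqP.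
have eU w : exists2 i : 'I_n, e i = U w & True.
  have Us : U w \in s.
    rewrite mem_undup; have : range U (U w) by exists w.
    by rewrite s0E.
  have Un : (index (U w) s < n)%N by rewrite index_mem.
  by exists (Ordinal Un); rewrite //= /e nth_index.
have mUe i : measurable (U @^-1` [set e i]) by exact: measurable_funPTI.
have /choice[k kd] : forall i, exists k, cond_density (U @^-1` [set e i]) Z k.
  by move=> i; exact: exists_cond_density.
have mk i : measurable_fun setT (k i) by have [] := kd i.
have k0 i z : (0 <= k i z)%R by have [] := kd i.
have mkZ i : measurable_fun setT (k i \o Z) by exact: measurableT_comp.
have kZ0 i w : (0 <= (k i \o Z) w)%R by exact: k0.
have mg i : measurable_fun setT (fun w => ((e i, V w), Z w)).
  by apply: measurable_fun_pair => //; exact: measurable_fun_pair.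
pose g i : {mfun W >-> ((T1 * T2) * T3)%type} :=
  HB.pack (fun w => ((e i, V w), Z w)) (isMeasurableFun.Build _ _ _ _ _ (mg i)).
(* [m i] is the law of [(e i, V, Z)] when [P] is reweighted by [k i \o Z]. *)
pose m i : {measure set ((T1 * T2) * T3) -> \bar R} :=
  sub_distribution (density_measure P (mkZ i) (kZ0 i)) (g i) measurableT.
have UE (E : set T1) : measurable E ->
    cond_density (U @^-1` E) Z (fun z => \sum_(i < n | e i \in E) k i z)%R.
  move=> mE; split.
  - under eq_fun do rewrite big_mkcond; apply: measurable_sum => i.
    by case: (e i \in E).
  - by move=> z; exact: sumr_ge0.
  move=> B mB.
  under eq_integral do rewrite -sumEFin -big_filter.
  rewrite ge0_integral_sum//; last 2 first.
  - by move=> i; exact/measurable_EFinP/measurable_funTS.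
  - by move=> i z _; rewrite lee_fin.
  transitivity (\sum_(i < n | e i \in E) P (U @^-1` [set e i] `&` Z @^-1` B)).
    rewrite -measure_bigsetU_ord_cond; last 2 first.
    - by move=> i _; apply: measurableI => //; exact: measurable_funPTI.
    - move=> i j _ _ [w [[/= Ui _] [/= Uj _]]]; apply/val_inj.
      by apply: (eI _ _ (ltn_ord i) (ltn_ord j)); rewrite -Ui -Uj.
    congr (P _); rewrite -(bigcup_pred [pred i : 'I_n | e i \in E]).
    apply/seteqP; split => w /= => [[Ew Zw]|[i /set_mem Ei [-> Zw]]//].
    by have [i ei _] := eU w; exists i; rewrite /= ?inE ei//; exact/mem_set.
  by rewrite big_filter; apply: eq_bigr => i _; have [_ _ ->] := kd i.
have mE E F G : measurable E -> measurable F -> measurable G ->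
    msum m n ((E `*` F) `*` G) =
    \sum_(i < n | e i \in E) \int[P]_(w in V @^-1` F `&` Z @^-1` G) (k i (Z w))%:E.
  move=> mE' mF mG; rewrite /msum [RHS]big_mkcond; apply: eq_bigr => i _.
  transitivity (\int[P]_(w in setT `&` g i @^-1` ((E `*` F) `*` G)) (k i (Z w))%:E).
    by [].
  case: ifPn => [/set_mem Ei|/negP Ei].
    by congr (integral _ _ _); apply/seteqP; split => w /=; tauto.
  rewrite (_ : _ `&` _ = set0) ?integral_set0//.
  by apply/seteqP; split => w //= [_ [[/mem_set]]].
have mEl E F G l : measurable E -> measurable F -> measurable G ->
    cond_density (V @^-1` F) Z l ->
    msum m n ((E `*` F) `*` G) =
    \int[distribution P Z]_(z in G) ((\sum_(i < n | e i \in E) k i z) * l z)%:E.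
  move=> mE' mF mG ld; have [ml l0 _] := ld.
  have mVF : measurable (V @^-1` F) by exact: measurable_funPTI.
  rewrite mE//; under [RHS]eq_integral do rewrite mulr_suml -sumEFin -big_filter.
  rewrite ge0_integral_sum//; last 2 first.
  - by move=> i; apply/measurable_EFinP/measurable_funTS; exact: measurable_funM.
  - by move=> i z _; rewrite lee_fin mulr_ge0.
  rewrite big_filter; apply: eq_bigr => i _.
  rewrite (integral_cond_density (f := EFin \o k i) mVF ld mG)//.
    exact/measurable_EFinP.
  by move=> z; rewrite /= lee_fin.
(* For full [E] and [F] one may take [l = 1], and the [k i] sum to a version of the probability of a
   sure event. *)
have m1 : msum m n setT = 1.
  have one : cond_density (V @^-1` [set: T2]) Z (cst 1%R).
    split => // B mB; rewrite preimage_setT setTI.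
    transitivity (1%:E * distribution P Z B); first by rewrite mul1e.
    by rewrite -integral_cst.
  rewrite -setXTT -setXTT (mEl _ _ _ _ _ _ _ one)//.
  under eq_integral do rewrite mulr1.
  have [_ _ <-//] := UE _ measurableT.
  by rewrite !preimage_setT setTI; exact: probability_setT.
pose Q : probability ((T1 * T2) * T3)%type R :=
  HB.pack (msum m n) (Measure_isProbability.Build _ _ _ (msum m n) m1).
exists Q; apply: is_cond_product_law_density => E F mE' mF.
have mVF : measurable (V @^-1` F) by exact: measurable_funPTI.
have [l ld] := exists_cond_density Z mVF; have [ml l0 _] := ld.
eexists; exists l; split; [exact: UE|by []|].
by move=> G mG; exact: mEl.
Qed.

End conditional_product_law.

(** * Conditional data processing *)

Section conditional_markov_chain.
Local Open Scope ereal_scope.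
Context {R : realType} d {W : measurableType d} {P : probability W R}.
Context dA dY dH dX {TA : measurableType dA} {TY : measurableType dY}
  {TH : measurableType dH} {TX : measurableType dX}.

(** For each [Q'] in the infimum for [(A, H, X)], a conditional product law [Q] for [(A, Y, X)] with
    no larger relative entropy is built. The finite range of [A] provides [Qh], which makes [A] and
    [(Y, H)] independent given [X]. *)
Lemma cond_mutual_information_markov (A : {RV P >-> TA}) (Y : {RV P >-> TY})
    (H : {RV P >-> TH}) (X : {RV P >-> TX}) :
  (forall a : TA, measurable [set a]) -> finite_set (range A) ->
  cond_independent Y A (paired H X) ->
  cond_mutual_information A Y X <= cond_mutual_information A H X.
Proof.
move=> mset1 finA YAHX; apply: le_ereal_inf_tmp => _ [Q' hQ' <-].
have [Qh hQh] := exists_cond_product_law (paired Y H) X mset1 finA.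
pose r (u : (TA * (TY * TH)) * TX) := (u.1.1, (u.1.2.1, (u.1.2.2, u.2))).
have mr : measurable_fun setT r.
  have m1 : measurable_fun setT (fun u : (TA * (TY * TH)) * TX => u.1).
    exact: measurable_fst.
  have m2 : measurable_fun setT (fun u : (TA * (TY * TH)) * TX => u.1.2).
    by apply: measurableT_comp => //; exact: measurable_snd.
  apply: measurable_fun_pair.
    by apply: measurableT_comp => //; exact: measurable_fst.
  apply: measurable_fun_pair.
    by apply: measurableT_comp => //; exact: measurable_fst.
  apply: measurable_fun_pair; last exact: measurable_snd.
  by apply: measurableT_comp => //; exact: measurable_snd.
pose r' : {mfun _ >-> _} := HB.pack r (isMeasurableFun.Build _ _ _ _ r mr).
(* [nu] is [Qh] with coordinates regrouped, so that [y] is in the middle and [(h, x)] plays the role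
   of [v]. *)
pose nu : probability (TA * (TY * (TH * TX)))%type R := distribution Qh r'.
pose q (u : TA * (TY * (TH * TX))) := ((u.1, u.2.1), u.2.2.2).
have mq : measurable_fun setT q.
  have m2 : measurable_fun setT (fun u : TA * (TY * (TH * TX)) => u.2).
    exact: measurable_snd.
  apply: measurable_fun_pair.
    apply: measurable_fun_pair; first exact: measurable_fst.
    by apply: measurableT_comp => //; exact: measurable_fst.
  do 2 (apply: measurableT_comp; first exact: measurable_snd).
  exact: measurable_snd.
pose q' : {mfun _ >-> _} := HB.pack q (isMeasurableFun.Build _ _ _ _ q mq).
(* Forgetting [h] in [nu] leaves the conditional product law of [A] and [Y]. *)
pose Q : probability ((TA * TY) * TX)%type R := distribution nu q'.
have nuE E k C : measurable E -> measurable C -> cond_density (A @^-1` E) X k ->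
    nu (E `*` C) = \int[P]_(w in (paired Y (paired H X)) @^-1` C) (k (X w))%:E.
  move=> mE mC kd.
  pose t (u : (TY * TH) * TX) := (u.1.1, (u.1.2, u.2)).
  have mt : measurable_fun setT t.
    apply: measurable_fun_pair.
      by apply: measurableT_comp; exact: measurable_fst.
    apply: measurable_fun_pair; last exact: measurable_snd.
    by apply: measurableT_comp; [exact: measurable_snd|exact: measurable_fst].
  have mtC : measurable (t @^-1` C) by rewrite -[X in measurable X]setTI; exact: mt.
  exact: etrans (cond_product_law_integral hQh mE kd mtC).
have cdT : cond_density (A @^-1` setT) X (cst 1%R).
  split => // B mB; rewrite preimage_setT setTI.
  transitivity (1%:E * distribution P X B); first by rewrite mul1e.
  by rewrite -integral_cst.
have hQ : is_cond_product_law A Y X Q.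
  apply: is_cond_product_law_density => E F mE mF.
  have mAE : measurable (A @^-1` E) by exact: measurable_funPTI.
  have mYF : measurable (Y @^-1` F) by exact: measurable_funPTI.
  have [k kd] := exists_cond_density X mAE.
  have [l ld] := exists_cond_density X mYF.
  exists k, l; split => // G mG.
  have ld' : cond_density (paired Y H @^-1` (F `*` setT)) X l.
    rewrite (_ : _ @^-1` _ = Y @^-1` F)//.
    by apply/seteqP; split => w /=; tauto.
  rewrite -(cond_product_law_density hQh mE (measurableX mF measurableT) mG kd ld').
  by congr (Qh _); apply/seteqP; split => -[[a [y h]] x] /=; tauto.
apply: ge_ereal_inf; exists (relative_entropy
  (distribution P (paired (paired A Y) X)) Q); first by exists Q.
apply: (@le_trans _ _ (relative_entropy
    (distribution P (paired A (paired Y (paired H X)))) nu)).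
  exact: (relative_entropy_pushforward mq).
apply: le_trans (relative_entropy_drop_middle YAHX _) _.
- move=> F k mF kd; have [mk k0 _] := kd.
  apply: cond_density_rectangles.
  + have -> : [set z : TA * (TY * (TH * TX)) | F z.2.1] = setT `*` (F `*` setT).
      by apply/seteqP; split => -[x [y z]] /=; tauto.
    by do 2 apply: measurableX => //.
  + exact: measurableT_comp.
  + by move=> z; exact: k0.
  move=> E B mE mB.
  have mAE : measurable (A @^-1` E) by exact: measurable_funPTI.
  have mYF : measurable (Y @^-1` F) by exact: measurable_funPTI.
  have [l ld] := exists_cond_density X mAE; have [ml l0 _] := ld.
  have mls : measurable_fun setT (EFin \o (l \o (@snd TH TX))).
    by apply/measurable_EFinP/measurableT_comp => //; exact: measurable_snd.
  have ms : measurable_fun setT (fun u : TA * (TY * (TH * TX)) => u.2.2).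
    by apply: measurableT_comp; exact: measurable_snd.
  pose s : {RV nu >-> (TH * TX)%type} :=
    HB.pack (fun u : TA * (TY * (TH * TX)) => u.2.2)
      (isMeasurableFun.Build _ _ _ _ _ ms).
  have mET : measurable (E `*` [set: TY * (TH * TX)]) by exact: measurableX.
  have sE C : measurable C ->
      distribution nu s C = distribution P (paired H X) C.
    move=> mC; transitivity (nu (setT `*` (setT `*` C))).
      by congr (nu _); apply/seteqP; split => -[a [y z]] /=; tauto.
    rewrite (nuE _ _ _ measurableT _ cdT); last exact: measurableX.
    transitivity (1%:E * P (paired Y (paired H X) @^-1` (setT `*` C))).
      by rewrite -integral_cst//; apply: measurable_funPTI; exact: measurableX.
    by rewrite mul1e; congr (P _); apply/seteqP; split => w /=; tauto.
  (* Under [nu] the conditional probability of [a \in E] given [(h, x)] depends on [x] only. *)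
  have sd : cond_density (E `*` [set: TY * (TH * TX)]) s (l \o snd).
    split; [by apply: measurableT_comp => //; exact: measurable_snd|
      by move=> z; exact: l0|].
    move=> C mC; transitivity (nu (E `*` (setT `*` C))).
      by congr (nu _); apply/seteqP; split => -[a [y z]] /=; tauto.
    rewrite (nuE _ _ _ mE _ ld); last exact: measurableX.
    rewrite [RHS](eq_measure_integral (distribution P (paired H X))); last first.
      by move=> D mD _; exact: sE.
    rewrite ge0_integral_pushforward; [|by []|exact: mC|
      exact: (measurable_funTS mls)|by move=> z _; rewrite lee_fin; exact: l0].
    by congr (integral _ _ _); apply/seteqP; split => w /=; tauto.
  transitivity (nu (E `*` (F `*` B))).
    by congr (nu _); apply/seteqP; split => -[a [y z]] /=; tauto.
  rewrite (nuE _ _ _ mE _ ld); last exact: measurableX.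
  transitivity (\int[P]_(w in Y @^-1` F `&` (paired H X) @^-1` B) (l (X w))%:E).
    by congr (integral _ _ _); apply/seteqP; split => w /=; tauto.
  rewrite (integral_cond_density (f := EFin \o (l \o snd)) mYF kd mB)//;
    last by move=> z; rewrite /= lee_fin; exact: l0.
  transitivity (\int[nu]_(u in (E `*` [set: TY * (TH * TX)]) `&` s @^-1` B)
      (EFin \o k) (s u)); last first.
    have mks : measurable_fun setT (fun z : TA * (TH * TX) => k z.2).
      by apply: measurableT_comp.
    rewrite [RHS]ge0_integral_pushforward; [|by []|exact: measurableX|
      by apply: measurable_funTS; exact/measurable_EFinP|
      by move=> z _; rewrite lee_fin; exact: k0].
    by congr (integral _ _ _); apply/seteqP; split => -[a [y z]] /=; tauto.
  rewrite (integral_cond_density (f := EFin \o k) mET sd mB)//; last first.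
    exact/measurable_EFinP.
  rewrite [RHS](eq_measure_integral (distribution P (paired H X))); last first.
    by move=> D mD _; exact: sE.
  by apply: eq_integral => z _; rewrite muleC.
(* Forgetting [y] in [nu] gives [Q'] up to regrouping, since both take the values of the conditional
   product law of [A] and [H] on boxes. *)
- pose p (u : (TA * TH) * TX) := (u.1.1, (u.1.2, u.2)).
  have mp : measurable_fun setT p.
    apply: measurable_fun_pair.
      by apply: measurableT_comp; exact: measurable_fst.
    apply: measurable_fun_pair; last exact: measurable_snd.
    by apply: measurableT_comp; [exact: measurable_snd|exact: measurable_fst].
  apply: (relative_entropy_pushforward mp) => // D mD.
  pose p' : {mfun _ >-> _} := HB.pack p (isMeasurableFun.Build _ _ _ _ p mp).
  transitivity (distribution Q' p' D) => //.
  apply: eq_measure_boxes => //.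
    by rewrite (le_lt_trans (probability_le1 _ measurableT))// ltry.
  move=> E F G mE mF mG.
  have mAE : measurable (A @^-1` E) by exact: measurable_funPTI.
  have mHF : measurable (H @^-1` F) by exact: measurable_funPTI.
  have [k kd] := exists_cond_density X mAE.
  have [l ld] := exists_cond_density X mHF.
  have ld' : cond_density (paired Y H @^-1` (setT `*` F)) X l.
    rewrite (_ : _ @^-1` _ = H @^-1` F)//.
    by apply/seteqP; split => w /=; tauto.
  transitivity (Q' ((E `*` F) `*` G)); last first.
    by congr (Q' _); apply/seteqP; split => -[[a h] x] /=; tauto.
  rewrite (cond_product_law_density hQ' mE mF mG kd ld).
  rewrite -(cond_product_law_density hQh mE (measurableX measurableT mF) mG kd ld').
  by congr (Qh _); apply/seteqP; split => -[[a [y h]] x] /=; tauto.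
Qed.

End conditional_markov_chain.

(** * The information carried by one edge *)

Section hoeffding.
Context {R : realType}.

(** The mean value theorem, used twice, gives [f x = x * c * f2 e] with [c] between [0] and [x]. *)
Lemma nonneg_second_derivative (f f1 f2 : R -> R) (x : R) :
  (forall t : R, is_derive t 1 f (f1 t)) ->
  (forall t : R, is_derive t 1 f1 (f2 t)) ->
  (forall t, 0 <= f2 t) -> f 0 = 0 -> f1 0 = 0 -> 0 <= f x.
Proof.
move=> df df1 f2_ge0 f00 f10.
have cont (g g' : R -> R) a b : (forall t : R, is_derive t 1 g (g' t)) ->
    {within `[a, b], continuous g}.
  move=> dg; apply: continuous_subspaceT => t.
  by apply/differentiable_continuous/derivable1_diffP; have [] := dg t.
have [x0|/ltW x0] := leP 0 x.
- have [c /itvP cx fxE] :=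
    MVT_segment x0 (fun t _ => df t) (cont f f1 0 x df).
  have c0 : 0 <= c by rewrite cx.
  have [e _ fcE] := MVT_segment c0 (fun t _ => df1 t) (cont f1 f2 0 c df1).
  rewrite f00 !subr0 in fxE; rewrite f10 !subr0 in fcE.
  by rewrite fxE fcE !mulr_ge0.
- have [c /itvP cx fxE] :=
    MVT_segment x0 (fun t _ => df t) (cont f f1 x 0 df).
  have c0 : c <= 0 by rewrite cx.
  have [e _ fcE] := MVT_segment c0 (fun t _ => df1 t) (cont f1 f2 c 0 df1).
  rewrite f00 !sub0r in fxE; rewrite f10 !sub0r in fcE.
  by rewrite -[f x]opprK fxE -[f1 c]opprK fcE mulNr opprK !mulr_ge0// oppr_ge0.
Qed.

(** After multiplication by [expR (t * p)] the left side is the moment generating function [s]; the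
    second derivative of [ln s] is the variance of the exponentially tilted variable, whose success
    probability is [r]. *)
Lemma hoeffding_bernoulli (p t : R) : 0 <= p <= 1 ->
  p * expR (t * (1 - p)) + (1 - p) * expR (- (t * p)) <= expR (t ^+ 2 / 8).
Proof.
move=> /andP[p0 p1].
pose s t : R := 1 - p + p * expR t.
have s_gt0 u : 0 < s u.
  rewrite /s; have [->|pn1] := eqVneq p 1.
    by rewrite subrr add0r mul1r expR_gt0.
  by rewrite ltr_pwDl ?subr_gt0 ?lt_neqAle ?pn1//= mulr_ge0// expR_ge0.
have ds (u : R) : is_derive u 1 s (p * expR u).
  have := is_deriveD (is_derive_cst (1 - p) u 1) (is_deriveZ p (is_derive_expR u)).
  rewrite add0r; have -> // : cst (1 - p) + p *: expR = s by apply/funext.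
have dV (u : R) : is_derive u 1 (fun v => (s v)^-1) (- (s u) ^- 2 * (p * expR u)).
  apply: DeriveDef; first by apply: derivableV => //; exact: lt0r_neq0.
  rewrite deriveV//; last exact: lt0r_neq0.
  by rewrite derive_val.
(* [f] is the logarithm of the ratio of the two sides; [f2] is nonnegative
   because [r (1 - r) <= 1 / 4]. *)
pose f u : R := u ^+ 2 / 8 + u * p - ln (s u).
pose f1 u : R := u / 4 + p - p * expR u * (s u)^-1.
pose r u : R := p * expR u / s u.
pose f2 u : R := 4^-1 - (r u - r u ^+ 2).
have df (u : R) : is_derive u 1 f (f1 u).
  have dln := is_derive1_comp (is_derive1_ln (s_gt0 u)) (ds u).
  rewrite (_ : f = 8^-1 *: (id ^+ 2) + p *: id - (@ln R \o s)); last first.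
    by apply/funext => v; rewrite /f /= !fctE /= mulrC [v * p]mulrC.
  apply: (is_derive_eq (is_deriveB (is_deriveD
    (is_deriveZ 8^-1 (is_deriveX 2 (is_derive_id u 1)))
    (is_deriveZ p (is_derive_id u 1))) dln)).
  rewrite /f1 /GRing.scale /=; field.
  exact: lt0r_neq0.
have df1 (u : R) : is_derive u 1 f1 (f2 u).
  rewrite (_ : f1 = 4^-1 *: id + cst p - (p *: expR) * (fun v => (s v)^-1)); last first.
    by apply/funext => v; rewrite /f1 /= !fctE /= mulrC.
  apply: (is_derive_eq (is_deriveB (is_deriveD
    (is_deriveZ 4^-1 (is_derive_id u 1)) (is_derive_cst p u 1))
    (is_deriveM (is_deriveZ p (is_derive_expR u)) (dV u)))).
  transitivity (4^-1 * 1 + 0 - (p * expR u * (- s u ^- 2 * (p * expR u)) +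
    (s u)^-1 * (p * expR u))); first by [].
  rewrite /f2 /r; field.
  exact: lt0r_neq0.
have : 0 <= f t.
  apply: (@nonneg_second_derivative f f1 f2 t df df1).
  - move=> u; rewrite /f2.
    by have : 0 <= (r u - 2^-1) ^+ 2 by [exact: sqr_ge0]; nra.
  - by rewrite /f /s expR0 mulr1 subrK ln1 expr0n mul0r mul0r addr0 subr0.
  - by rewrite /f1 /s expR0 mulr1 subrK invr1 mulr1 mul0r add0r subrr.
rewrite /f subr_ge0 -ler_expR lnK ?posrE// => st.
rewrite -(ler_pM2r (expR_gt0 (t * p))) -expRD (le_trans _ st)//.
rewrite mulrDl -!mulrA -!expRD addNr expR0 mulr1 mulrBr mulr1 subrK /s.
by rewrite addrC.
Qed.

End hoeffding.

Section finite_integral.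
Local Open Scope ereal_scope.
Context {R : realType} d {T : measurableType d}.
Variables (I : finType) (x : I -> T).
Hypotheses (x_inj : injective x) (x_surj : forall t, exists i, x i = t).
Hypothesis mset1 : forall i, measurable [set x i].

Let sum_indic (f : T -> R) (t : T) :
  f t = (\sum_(i : I) f (x i) * \1_[set x i] t)%R.
Proof.
have [i <-] := x_surj t; rewrite (bigD1 i)//= indicE mem_set// mulr1.
rewrite big1 ?addr0// => j ji; rewrite indicE memNset ?mulr0//=.
by move=> /x_inj ij; rewrite ij eqxx in ji.
Qed.

(** A product of finite spaces carries the product sigma-algebra, so measurability of every function
    has to come from that of the points. *)
Lemma measurable_fun_finite (f : T -> R) : measurable_fun setT f.
Proof.
rewrite (funext (sum_indic f)); apply: measurable_sum => i.
by apply: measurable_funM => //; exact: measurable_indic.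
Qed.

Lemma integral_finite (m : probability T R) (f : T -> R) :
  \int[m]_t (f t)%:E = (\sum_i f (x i) * fine (m [set x i]))%:E.
Proof.
under eq_integral do rewrite sum_indic -sumEFin.
rewrite integral_sum//; last first.
  move=> i; under eq_fun do rewrite EFinM.
  by apply: integrableZl => //; exact: integrable_indic.
rewrite -sumEFin; apply: eq_bigr => i _.
under eq_integral do rewrite EFinM.
rewrite integralZl//; last exact: integrable_indic.
by rewrite integral_indic// setIT EFinM fineK// fin_num_measure.
Qed.

End finite_integral.

(** * Laws of label pairs and edges in the block model *)

Section block_model_marginals.
Context {R : realType} d {W : measurableType d} {P : probability W R}.

Lemma prob_partition d' {T : measurableType d'} (I : finType) (f : T -> I)
    (Y : {RV P >-> T}) (S : pred I) (D : set W) :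
  (forall i, measurable (f @^-1` [set i])) -> measurable D ->
  prob P (D `&` [set w | S (f (Y w))]) =
  \sum_(i | S i) prob P (D `&` [set w | f (Y w) = i]).
Proof.
move=> mf mD.
have mYf i : measurable [set w | f (Y w) = i].
  exact: (measurable_funPTI Y (mf i)).
have -> : D `&` [set w | S (f (Y w))] =
    \bigcup_(i in [set` enum S]) (D `&` [set w | f (Y w) = i]).
  apply/seteqP; split => w /=; last first.
    by move=> [i /= iS [Dw ->]]; split => //; move: iS; rewrite mem_enum.
  by move=> [Dw Sw]; exists (f (Y w)) => //=; rewrite mem_enum.
rewrite /prob measure_fin_bigcup//; last 2 first.
- by move=> i j _ _ [w [[_ <-] [_ <-]]].
- by move=> i _; exact: measurableI.
rewrite -fsbig_seq ?enum_uniq// big_enum/= sum_fine//.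
by move=> i _; apply: fin_num_measure; exact: measurableI.
Qed.

Lemma prob_total d' {T : measurableType d'} (I : finType) (f : T -> I)
    (Y : {RV P >-> T}) (D : set W) :
  (forall i, measurable (f @^-1` [set i])) -> measurable D ->
  prob P D = \sum_i prob P (D `&` [set w | f (Y w) = i]).
Proof.
move=> mf mD; rewrite -(prob_partition Y predT mf mD); congr (prob P _).
by apply/seteqP; split => w //= [].
Qed.

Context (N c : nat) (pi : 'I_c.+1 -> R) (p_in p_out : R).
Variables (Y : {RV P >-> {ffun 'I_N -> 'I_c.+1}}) (A : {RV P >-> 'M[bool]_N}).
Hypothesis sbm : is_sbm pi p_in p_out Y A.

Lemma sbm_label_pair_law (i j : 'I_N) (a b : 'I_c.+1) : i != j ->
  prob P [set w | Y w i = a /\ Y w j = b] = pi a * pi b.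
Proof.
move=> ij; pose E (k : 'I_N) : set 'I_c.+1 := if k == i then [set a] else [set b].
have mE k : measurable (E k) by [].
have := sbm_label_indep sbm (finset.subsetT [set i; j]%SET) mE.
rewrite big_setU1 ?inE//= big_set1 /E eqxx eq_sym (negbTE ij).
rewrite -(sbm_label_law sbm i a) -(sbm_label_law sbm j b) => <-.
congr (prob P _); apply/seteqP; split => w /=.
  move=> [Yi Yj] k /=; rewrite !inE => /orP[/eqP ->|/eqP ->]; first by rewrite eqxx.
  by rewrite eq_sym (negbTE ij).
move=> h; have := h i; have := h j; rewrite /= !inE !eqxx orbT eq_sym (negbTE ij) /=.
by move=> /(_ isT) ? /(_ isT).
Qed.

(** The edge law is given for full label vectors; it is summed over the [y] with [y i = a] and
    [y j = b], on which the connectivity is constant. *)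
Lemma sbm_edge_label_law (i j : 'I_N) (a b : 'I_c.+1) : (i < j)%N ->
  prob P ([set w | A w i j] `&` [set w | Y w i = a /\ Y w j = b]) =
  connectivity p_in p_out a b * (pi a * pi b).
Proof.
move=> ij; have ij' : i != j by rewrite neq_ltn ij.
have mA : measurable [set w | A w i j].
  exact: (measurable_funPTI A (_ : measurable [set m : 'M[bool]_N | m i j])).
pose S (y : {ffun 'I_N -> 'I_c.+1}) := (y i == a) && (y j == b).
have SE : [set w | Y w i = a /\ Y w j = b] = [set w | S (Y w)].
  apply/seteqP; split => w; rewrite /S/=; first by move=> [-> ->]; rewrite !eqxx.
  by move=> /andP[/eqP -> /eqP ->].
rewrite -(sbm_label_pair_law a b ij') SE.
pose f (y : {ffun 'I_N -> 'I_c.+1}) : {ffun 'I_N -> 'I_c.+1} := y.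
have part D := prob_partition (I := {ffun 'I_N -> 'I_c.+1}) (f := f) Y S
  (D := D) (fun=> I).
rewrite -[in RHS](setTI [set w | S (Y w)]) (part _ mA) (part _ measurableT).
rewrite mulr_sumr; apply: eq_bigr => y /andP[/eqP ya /eqP yb].
rewrite setTI.
have mY : measurable [set w | Y w = y].
  exact: (measurable_funPTI Y (_ : measurable [set y])).
(* For a null label vector the model fixes no conditional law, but both sides are [0]. *)
have [P0|P0] := leP (prob P [set w | Y w = y]) 0.
  have Y0 : prob P [set w | Y w = y] = 0.
    by apply/eqP; rewrite eq_le P0 fine_ge0.
  rewrite Y0 mulr0; apply/eqP; rewrite eq_le fine_ge0// andbT -Y0.
  apply: fine_le; rewrite ?fin_num_measure//; first exact: measurableI.
  by apply: le_measure; rewrite ?inE//; exact: measurableI.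
rewrite -ya -yb -(sbm_edge_law sbm P0 ij) /prob_given divfK//.
exact: lt0r_neq0.
Qed.

Lemma sbm_label_ge0 (i : 'I_N) (a : 'I_c.+1) : 0 <= pi a.
Proof. by rewrite -(sbm_label_law sbm i a) fine_ge0. Qed.

Lemma sbm_label_sum1 (i : 'I_N) : \sum_a pi a = 1.
Proof.
have <- : prob P setT = 1.
  by rewrite /prob [X in fine X](_ : _ = 1%E)//; exact: probability_setT.
rewrite (prob_total (f := fun y : {ffun 'I_N -> 'I_c.+1} => y i) Y (fun=> I))//.
by apply: eq_bigr => a _; rewrite setTI (sbm_label_law sbm).
Qed.

(** Two independent labels coincide with probability [\sum_a pi a ^+ 2]; the vertex [i] ensures that
    [pi] sums to [1]. *)
Lemma connectivity_average (i : 'I_N) (g : R -> R) :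
  \sum_a \sum_b pi a * pi b * g (connectivity p_in p_out a b) =
  (\sum_a pi a ^+ 2) * g p_in + (1 - \sum_a pi a ^+ 2) * g p_out.
Proof.
have pi1 := sbm_label_sum1 i.
transitivity (\sum_a (pi a * g p_out + pi a ^+ 2 * (g p_in - g p_out))).
  apply: eq_bigr => a _; rewrite (bigD1 a)//= /connectivity eqxx.
  rewrite (eq_bigr (fun b => pi a * g p_out * pi b)); last first.
    by move=> b ba; rewrite eq_sym (negbTE ba); ring.
  rewrite -mulr_sumr; move: pi1; rewrite (bigD1 a)//=.
  set s := (\sum_(_ < _ | _) _) => pi1.
  have -> : s = 1 - pi a by rewrite -pi1; ring.
  ring.
rewrite big_split /= -!mulr_suml pi1; ring.
Qed.

End block_model_marginals.

Lemma setX_set1 T1 T2 (a : T1) (b : T2) : [set a] `*` [set b] = [set (a, b)].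
Proof. by apply/seteqP; split => -[x y] /= [-> ->]. Qed.

(** * The lower bound for one edge *)

Section edge_information.
Context {R : realType} d {W : measurableType d} {P : probability W R}.
Context (N c : nat) (pi : 'I_c.+1 -> R) (p_in p_out : R).
Variables (Y : {RV P >-> {ffun 'I_N -> 'I_c.+1}}) (A : {RV P >-> 'M[bool]_N}).
Hypothesis sbm : is_sbm pi p_in p_out Y A.

Lemma edge_information_ge (i j : 'I_N) :
  let alpha := \sum_a pi a ^+ 2 in
  let p_bar := alpha * p_in + (1 - alpha) * p_out in
  (i < j)%N -> 0 <= p_bar <= 1 ->
  ((2 * alpha * (1 - alpha) * (p_in - p_out) ^+ 2)%:E <=
   mutual_information (edge A i j) (label_pair Y i j))%E.
Proof.
move=> alpha p_bar ij p_bar01.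
pose L := label_pair Y i j; pose e0 := edge A i j.
pose mu : probability (bool * ('I_c.+1 * 'I_c.+1))%type R :=
  distribution P (paired e0 L).
pose nu : probability (bool * ('I_c.+1 * 'I_c.+1))%type R :=
  (distribution P e0 \x distribution P L)%E.
pose B := @connectivity R c p_in p_out.
have ij' : i != j by rewrite neq_ltn ij.
have mab (a b : 'I_c.+1) : measurable [set (a, b)].
  by rewrite -setX_set1; exact: measurableX.
have mL (a b : 'I_c.+1) : measurable (L @^-1` [set (a, b)]).
  exact: measurable_funPTI.
have me (e : bool) : measurable (e0 @^-1` [set e]) by exact: measurable_funPTI.
have LE (a b : 'I_c.+1) :
    L @^-1` [set (a, b)] = [set w | Y w i = a /\ Y w j = b].
  by apply/seteqP; split => w /=; [move=> [<- <-]|move=> [<- <-]].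
have eT : e0 @^-1` [set true] = [set w | A w i j].
  by apply/seteqP; split.
have piw (a b : 'I_c.+1) : fine (distribution P L [set (a, b)]) = pi a * pi b.
  by rewrite -(sbm_label_pair_law sbm a b ij') -LE.
have edgew (a b : 'I_c.+1) (e : bool) :
    prob P (e0 @^-1` [set e] `&` L @^-1` [set (a, b)]) =
    pi a * pi b * (if e then B a b else 1 - B a b).
  have eTw : prob P (e0 @^-1` [set true] `&` L @^-1` [set (a, b)]) =
      pi a * pi b * B a b.
    by rewrite eT LE (sbm_edge_label_law sbm)// mulrC.
  case: e => //.
  have := @prob_total _ _ _ P _ bool bool id e0 _ (fun=> I) (mL a b).
  have setE (e : bool) : prob P (L @^-1` [set (a, b)] `&` [set w | id (e0 w) = e]) =
      prob P (e0 @^-1` [set e] `&` L @^-1` [set (a, b)]).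
    by rewrite setIC.
  rewrite big_bool !setE eTw => LP.
  have -> : prob P (e0 @^-1` [set false] `&` L @^-1` [set (a, b)]) =
    pi a * pi b - pi a * pi b * B a b.
    apply/eqP; rewrite eq_sym subr_eq [X in _ == X]addrC.
    exact/eqP/(etrans (esym (piw a b)) LP).
  by rewrite mulrBr mulr1.
have edgep (e : bool) : fine (distribution P e0 [set e]) =
    if e then p_bar else 1 - p_bar.
  have mS (l : 'I_c.+1 * 'I_c.+1) : measurable (id @^-1` [set l]).
    by case: l => a b; rewrite preimage_id.
  have := @prob_total _ _ _ P _ _ ('I_c.+1 * 'I_c.+1)%type id L _ mS (me e).
  rewrite /prob => /= ->.
  rewrite (eq_bigr (fun l => pi l.1 * pi l.2 *
    (if e then B l.1 l.2 else 1 - B l.1 l.2))); last first.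
    by move=> [a b] _; rewrite -edgew.
  rewrite -(pair_bigA _ (fun a b => pi a * pi b * (if e then B a b else 1 - B a b)))/=.
  rewrite (connectivity_average sbm i (fun x => if e then x else 1 - x)).
  by case: e => //; rewrite /p_bar -/alpha; ring.
have edgew' (a b : 'I_c.+1) (e : bool) : fine (mu [set (e, (a, b))]) =
    pi a * pi b * (if e then B a b else 1 - B a b).
  rewrite -edgew; congr (fine (P _)).
  by apply/seteqP; split => w /=; [move=> [<- <- <-]|move=> [<- [<- <-]]].
have nuw (a b : 'I_c.+1) (e : bool) : fine (nu [set (e, (a, b))]) =
    pi a * pi b * (if e then p_bar else 1 - p_bar).
  have -> : [set (e, (a, b))] = [set e] `*` ([set a] `*` [set b]).
    by rewrite !setX_set1.
  rewrite /nu /= product_measure1E//; last exact: measurableX.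
  rewrite fineM ?fin_num_measure//; last exact: measurableX.
  by rewrite setX_set1 edgep piw mulrC.
pose x (z : bool * ('I_c.+1 * 'I_c.+1)) : bool * ('I_c.+1 * 'I_c.+1) := z.
have xinj : injective x by [].
have xsurj : forall z, exists k, x k = z by move=> z; exists z.
have mx k : measurable [set x k].
  by case: k => e [a b]; rewrite /x -setX_set1; exact: measurableX.
have sumE (F : bool * ('I_c.+1 * 'I_c.+1) -> R) :
    \sum_z F z = \sum_a \sum_b (F (true, (a, b)) + F (false, (a, b))).
  rewrite (eq_bigr (fun z => F (z.1, (z.2.1, z.2.2)))); last by case=> ? [].
  rewrite -(pair_bigA _ (fun e l => F (e, (l.1, l.2))))/= big_bool /=.
  rewrite -(pair_bigA _ (fun a b => F (true, (a, b))))/=.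
  rewrite -(pair_bigA _ (fun a b => F (false, (a, b))))/= -big_split/=.
  by apply: eq_bigr => a _; rewrite big_split.
(* Given labels [(a, b)], the mean of [phi] is [t * (B a b - p_bar) - t ^+ 2 / 8]; this [t]
   maximizes it, with value [2 * (B a b - p_bar) ^+ 2]. *)
pose t a b := 4 * (B a b - p_bar).
pose phi (z : bool * ('I_c.+1 * 'I_c.+1)) : R :=
  t z.2.1 z.2.2 * (z.1%:R - p_bar) - t z.2.1 z.2.2 ^+ 2 / 8.
have mphi f : measurable_fun setT f := measurable_fun_finite xinj xsurj mx f.
have -> : (2 * alpha * (1 - alpha) * (p_in - p_out) ^+ 2)%:E =
    (\int[mu]_z (ln (expR (phi z)))%:E)%E.
  rewrite (integral_finite xinj xsurj mx) sumE; congr EFin.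
  transitivity (\sum_a \sum_b pi a * pi b * (2 * (B a b - p_bar) ^+ 2)).
    (* The deviations from [p_bar] are [(1 - alpha) * (p_in - p_out)] and
       [- alpha * (p_in - p_out)]. *)
    rewrite (connectivity_average sbm i (fun y => 2 * (y - p_bar) ^+ 2)) -/alpha.
    by rewrite /p_bar; ring.
  apply: eq_bigr => a _; apply: eq_bigr => b _.
  by rewrite !expRK /x !edgew' /phi /t /=; field.
apply: (gibbs_inequality (mu := mu) (nu := nu) (h := expR \o phi)) => //.
- by move=> z; exact: expR_ge0.
- by apply: aeW => z; exact: expR_gt0.
rewrite (integral_finite xinj xsurj mx) sumE lee_fin.
(* Under [nu] the edge is Bernoulli with parameter [p_bar] whatever the labels, so Hoeffding's lemma
   bounds each inner sum. *)
apply: (@le_trans _ _ (\sum_a \sum_b pi a * pi b)).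
  apply: ler_sum => a _; apply: ler_sum => b _.
  rewrite /x !nuw /=.
  have h := hoeffding_bernoulli (t a b) p_bar01.
  rewrite -(ler_pM2r (expR_gt0 (- (t a b ^+ 2 / 8)))) -[leRHS]expRD in h.
  rewrite subrr expR0 in h.
  have pab : 0 <= pi a * pi b by rewrite mulr_ge0// (sbm_label_ge0 sbm i).
  rewrite -[leRHS]mulr1; apply: le_trans (ler_wpM2l pab h).
  rewrite /phi /= !expRD sub0r mulrN.
  by rewrite le_eqVlt; apply/orP; left; apply/eqP; ring.
under eq_bigr do rewrite -mulr_sumr.
by rewrite -mulr_suml (sbm_label_sum1 sbm i) mulr1.
Qed.

End edge_information.


(** * Combination of the edge bound with data processing *)

Theorem theorem21 (R : realType) (d : measure_display) (W : measurableType d)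
    (P : probability W R) (N c : nat) (hN : (1 < N)%N)
    (pi : 'I_c.+1 -> R) (p_in p_out : R)
    (Y : {RV P >-> {ffun 'I_N -> 'I_c.+1}}) (A : {RV P >-> 'M[bool]_N})
    (hp_in : 0 <= p_in <= 1) (hp_out : 0 <= p_out <= 1)
    (hsbm : is_sbm pi p_in p_out Y A) :
  let alpha : R := \sum_(a < c.+1) pi a ^+ 2 in
  let alpha_bar : R := 1 - alpha in
  let p_bar : R := alpha * p_in + alpha_bar * p_out in
  let Delta : R := p_in - p_out in
  let bound : \bar R := (2 * alpha * alpha_bar * Delta ^+ 2)%:E in
  let v1 : 'I_N := Ordinal (ltnW hN) in
  let v2 : 'I_N := Ordinal hN in
  0 < p_bar < 1 ->
  [/\ forall i j : 'I_N, (i < j)%N ->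
        (bound <= mutual_information (edge A i j) (label_pair Y i j))%E,
      (* featureless: no feature variable *)
      forall (dH : measure_display) (TH : measurableType dH)
        (H : {RV P >-> TH}),
        task_sufficient_featureless A Y H ->
        [/\ (mutual_information A Y <= mutual_information A H)%E,
            (mutual_information (edge A v1 v2) (label_pair Y v1 v2) <=
             mutual_information A Y)%E &
            (bound <=
             mutual_information (edge A v1 v2) (label_pair Y v1 v2))%E],
      (* featureless: constant feature variable *)
      forall (dX dH : measure_display) (TX : measurableType dX)
        (TH : measurableType dH) (X : {RV P >-> TX}) (H : {RV P >-> TH}),
        task_sufficient A X Y H ->
        (exists x : TX, forall w, X w = x) ->
        [/\ (mutual_information A Y <= mutual_information A H)%E,
            (mutual_information (edge A v1 v2) (label_pair Y v1 v2) <=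
             mutual_information A Y)%E &
            (bound <=
             mutual_information (edge A v1 v2) (label_pair Y v1 v2))%E] &
      (* informative features *)
      forall (dX dH : measure_display) (TX : measurableType dX)
        (TH : measurableType dH) (X : {RV P >-> TX}) (H : {RV P >-> TH}),
        task_sufficient A X Y H ->
        (cond_mutual_information A Y X <= cond_mutual_information A H X)%E /\
        (bound <= mutual_information A Y)%E].
Proof.
move=> alpha alpha_bar p_bar Delta bound v1 v2 /andP[p_bar_gt0 p_bar_lt1].
have edge_ge (i j : 'I_N) : (i < j)%N ->
    (bound <= mutual_information (edge A i j) (label_pair Y i j))%E.
  move=> ij; apply: (edge_information_ge hsbm ij).
  by rewrite !ltW.
have edge_ge12 := edge_ge v1 v2 isT.
have edge_le : (mutual_information (edge A v1 v2) (label_pair Y v1 v2) <=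
    mutual_information A Y)%E.
  apply: (mutual_information_comp (U := A) (V := Y) (U' := edge A v1 v2)
    (V' := label_pair Y v1 v2) (f := entry v1 v2)
    (g := fun y : {ffun 'I_N -> 'I_c.+1} => (y v1, y v2))) => //.
split => //.
- move=> dH TH H [_ YAH]; split => //.
  exact: mutual_information_markov YAH.
- move=> dX dH TX TH X H [_ YAHX] [x Xx]; split => //.
  apply: le_trans (mutual_information_markov YAHX) _.
  (* For constant [X] the pair [(H, X)] is a function of [H]. *)
  apply: (mutual_information_comp (f := id) (g := fun h => (h, x))) => //.
  by move=> w; rewrite -(Xx w).
- move=> dX dH TX TH X H [_ YAHX]; split; last exact: le_trans edge_ge12 edge_le.
  (* There are finitely many adjacency matrices, so the required conditional product law exists. *)
  by apply: cond_mutual_information_markov => //; exact: finite_finset.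
Qed.
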